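(* Let $B$ be an octonion algebra over $R$. (a) $B$ is a central $R$-algebra satisfying $(B,B,B)+[B,B] = (B,B,B) = [B,B]$. (b) The bilinear form $\tau \colon B \times B \to R$, defined by $\tau(x,y) = t_B(xy)$, is an invariant, nonsingular and $\mathbf{Aut}(B)$-invariant $R$-bilinear form. It coincides with the form $\tau_B$ obtained by descent from the bilinear form $\tau(x,y)=t_{\mathrm{Zor}(R)}(xy)$ of $\mathrm{Zor}(R)$ with respect to any splitting $B \otimes_R S \simeq \mathrm{Zor}(S)$ of $B$. (c) $(B,\tau)$ satisfies the IBF-principle: the $R$-linear map $\mathbf{IBF}_R(B) \to R$, $\overline{b_1\otimes b_2}\mapsto \tau(b_1,b_2)$, is an isomorphism of $R$-modules.
   Context: $k$ is a commutative associative unital ring and $R$ is a commutative associative unital $k$-algebra. An $R$-algebra $B$ is an octonion algebra if its underlying $R$-module is projective of constant rank $8$, it has an identity element $1_B$, and it admits a quadratic form $n_B\colon B\to R$ (the norm) whose associated bilinear form $n_B(a,b)=n_B(a+b)-n_B(a)-n_B(b)$ is nonsingular and which satisfies $n_B(ab)=n_B(a)n_B(b)$; the trace is $t_B=n_B(1_B,-)$. The split octonions $\mathrm{Zor}(R)$ are the Zorn vector matrices $\left[\begin{smallmatrix}\alpha_1 & u\\ x & \alpha_2\end{smallmatrix}\right]$, $\alpha_i\in R$, $u,x\in R^3$, with product $\left[\begin{smallmatrix}\alpha_1 & u\\ x & \alpha_2\end{smallmatrix}\right]\left[\begin{smallmatrix}\beta_1 & v\\ y & \beta_2\end{smallmatrix}\right]=\left[\begin{smallmatrix}\alpha_1\beta_1-{}^tu\,y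 & \alpha_1 v+\beta_2 u+x\times y\\ \beta_1 x+\alpha_2 y+u\times v & -{}^tx\,v+\alpha_2\beta_2\end{smallmatrix}\right]$ (usual scalar and vector products on $R^3$), norm $\alpha_1\alpha_2+{}^tu\,x$ and trace $\alpha_1+\alpha_2$. An $R$-algebra is an octonion algebra iff $B\otimes_R S\simeq \mathrm{Zor}(S)$ for some faithfully flat $S\in R$-alg. $(B,B,B)$ is the span of associators $(ab)c-a(bc)$ and $[B,B]$ the span of commutators $ab-ba$. $B$ is central if $r\mapsto (b\mapsto rb)$ is an isomorphism of $R$ onto the centroid of $B$. A bilinear form $\beta$ is invariant if $\beta(ab,c)=\beta(a,bc)=\beta(b,ca)$; nonsingular if $b\mapsto\beta(b,-)$ is a bijection $B\to\mathrm{Hom}_R(B,R)$; $\mathbf{Aut}(B)$-invariant if for every $S\in R$-alg its base change $\beta_S$ to $B\otimes_R S$ is invariant under all $S$-algebra automorphisms of $B\otimes_R S$. The descended form $\tau_B$ is the unique $R$-bilinear form on $B$ with $(\tau_B)_S=\theta^*(\tau_S)$ for every faithfully flat $S$ and $S$-algebra isomorphism $\theta\colon B\otimes_R S\to \mathrm{Zor}(S)$. $\mathbf{IBF}_R(B)$ is the quotient of $B\otimes_R B$ by the span of $ab\otimes c-a\otimes bc$ and $ab\otimes c-b\otimes ca$. *)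

(* Defs.v *)
From HB Require Import structures.
From mathcomp Require Import all_boot all_algebra.
Set Implicit Arguments.
Unset Strict Implicit.
Unset Printing Implicit Defensive.
Import GRing.Theory.
Local Open Scope ring_scope.

Definition is_lin (R : pzRingType) (M N : lmodType R) (f : M -> N) : Prop :=
  forall (r : R) (x y : M), f (r *: x + y) = r *: f x + f y.

Definition is_lform (R : pzRingType) (M : lmodType R) (f : M -> R) : Prop :=
  forall (r : R) (x y : M), f (r *: x + y) = r * f x + f y.

Definition is_bilinear (R : pzRingType) (M : lmodType R) (b : M -> M -> R) : Prop :=
  (forall z, is_lform (fun x => b x z)) /\ (forall x, is_lform (fun z => b x z)).

Definition is_bilin_map (R : pzRingType) (M N : lmodType R) (b : M -> M -> N) : Prop :=
  (forall z, is_lin (fun x => b x z)) /\ (forall x, is_lin (fun z => b x z)).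

Definition nonsingular (R : pzRingType) (M : lmodType R) (b : M -> M -> R) : Prop :=
  (forall x x' : M, (forall y, b x y = b x' y) -> x = x') /\
  (forall f : M -> R, is_lform f -> exists x : M, forall y, f y = b x y).

(* R-linear maps M -> N where N is a module over an R-algebra S
   (i.e. R-linear for the restriction of scalars) *)
Definition is_semilin (R : comPzRingType) (S : comAlgType R) (M : lmodType R)
  (N : lmodType S) (f : M -> N) : Prop :=
  forall (r : R) (x y : M), f (r *: x + y) = (r%:A : S) *: f x + f y.

(* base change: (MS, i) is M (x)_R S with i m = m (x) 1, characterised by
   the universal property of the extension of scalars *)
Definition is_base_change (R : comPzRingType) (S : comAlgType R) (M : lmodType R)
  (MS : lmodType S) (i : M -> MS) : Prop :=
  is_semilin i /\
  forall (N : lmodType S) (f : M -> N), is_semilin f ->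
    (exists g : MS -> N, is_lin g /\ forall m, g (i m) = f m) /\
    (forall g g' : MS -> N, is_lin g -> is_lin g' ->
       (forall m, g (i m) = g' (i m)) -> forall x, g x = g' x).

Definition is_form_base_change (R : comPzRingType) (S : comAlgType R)
  (M : lmodType R) (MS : lmodType S) (i : M -> MS)
  (beta : M -> M -> R) (betaS : MS -> MS -> S) : Prop :=
  is_bilinear betaS /\ forall x y, betaS (i x) (i y) = (beta x y)%:A.

Definition flat (R : comPzRingType) (S : comAlgType R) : Prop :=
  forall (M N : lmodType R) (f : M -> N) (MS NS : lmodType S)
         (iM : M -> MS) (iN : N -> NS) (fS : MS -> NS),
    is_lin f -> injective f -> is_base_change iM -> is_base_change iN ->
    is_lin fS -> (forall m, fS (iM m) = iN (f m)) -> injective fS.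

Definition faithfully_flat (R : comPzRingType) (S : comAlgType R) : Prop :=
  flat S /\
  forall (M : lmodType R) (MS : lmodType S) (iM : M -> MS),
    is_base_change iM -> (forall x : MS, x = 0) -> forall m : M, m = 0.

Definition fg_projective (R : pzRingType) (M : lmodType R) : Prop :=
  exists (k : nat) (p : 'rV[R]_k -> M) (s : M -> 'rV[R]_k),
    is_lin p /\ is_lin s /\ forall m, p (s m) = m.

Definition is_field_alg (R : comPzRingType) (S : comAlgType R) : Prop :=
  (1 : S) != 0 /\ forall x : S, x != 0 -> exists y : S, x * y = 1.

Definition free_of_rank (S : pzRingType) (M : lmodType S) (d : nat) : Prop :=
  exists e : 'I_d -> M,
    (forall c : 'I_d -> S, \sum_(j < d) c j *: e j = 0 -> forall j, c j = 0) /\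
    (forall v : M, exists c : 'I_d -> S, v = \sum_(j < d) c j *: e j).

(* projective of constant rank d: f.g. projective, and of rank d at every
   point of Spec R, i.e. M (x)_R K has dimension d for every field K over R *)
Definition proj_const_rank (R : comPzRingType) (M : lmodType R) (d : nat) : Prop :=
  fg_projective M /\
  forall (K : comAlgType R) (MK : lmodType K) (i : M -> MK),
    is_field_alg K -> is_base_change i -> free_of_rank MK d.

Record naalg (R : pzRingType) := NAAlg {
  na_sort :> lmodType R;
  na_mul : na_sort -> na_sort -> na_sort;
  na_one : na_sort }.

Arguments na_mul {R} _ _ _.
Arguments na_one {R} _.

Definition is_unital_alg (R : pzRingType) (A : naalg R) : Prop :=
  is_bilin_map (na_mul A) /\
  forall x : A, na_mul A (na_one A) x = x /\ na_mul A x (na_one A) = x.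

Definition is_alg_base_change (R : comPzRingType) (S : comAlgType R)
  (A : naalg R) (AS : naalg S) (i : A -> AS) : Prop :=
  is_unital_alg AS /\ is_base_change i /\ i (na_one A) = na_one AS /\
  forall x y, i (na_mul A x y) = na_mul AS (i x) (i y).

Definition is_alg_iso (S : pzRingType) (A C : naalg S) (f : A -> C) : Prop :=
  is_lin f /\ bijective f /\ f (na_one A) = na_one C /\
  forall x y, f (na_mul A x y) = na_mul C (f x) (f y).

Definition polar (R : pzRingType) (M : lmodType R) (q : M -> R) (x y : M) : R :=
  q (x + y) - q x - q y.

Definition is_quadratic_form (R : pzRingType) (M : lmodType R) (q : M -> R) : Prop :=
  (forall (r : R) x, q (r *: x) = r ^+ 2 * q x) /\ is_bilinear (polar q).

Definition is_octonion (R : comPzRingType) (B : naalg R) (n : B -> R) : Prop :=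
  is_unital_alg B /\ proj_const_rank B 8 /\
  is_quadratic_form n /\ nonsingular (polar n) /\
  forall x y, n (na_mul B x y) = n x * n y.

Definition trace (R : pzRingType) (B : naalg R) (n : B -> R) (x : B) : R :=
  polar n (na_one B) x.

Definition tau (R : pzRingType) (B : naalg R) (n : B -> R) (x y : B) : R :=
  trace n (na_mul B x y).

(* Split octonions Zor(S), carried by 'rV[S]_8:                        *)
(*   coordinates 0,1 = alpha_1, alpha_2 ; 2,3,4 = u ; 5,6,7 = x       *)

Section Zorn.
Variable S : comPzRingType.

Definition zA1 (z : 'rV[S]_8) : S := z 0 (inord 0).
Definition zA2 (z : 'rV[S]_8) : S := z 0 (inord 1).
Definition zU (z : 'rV[S]_8) : 'rV[S]_3 := \row_(k < 3) z 0 (inord (2 + k)).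
Definition zX (z : 'rV[S]_8) : 'rV[S]_3 := \row_(k < 3) z 0 (inord (5 + k)).

Definition zmk (a1 a2 : S) (u x : 'rV[S]_3) : 'rV[S]_8 :=
  \row_(j < 8) (if (j : nat) == 0%N then a1
                else if (j : nat) == 1%N then a2
                else if (j < 5)%N then u 0 (inord (j - 2))
                else x 0 (inord (j - 5))).

Definition dot3 (u v : 'rV[S]_3) : S := \sum_(k < 3) u 0 k * v 0 k.

Definition cross3 (u v : 'rV[S]_3) : 'rV[S]_3 :=
  let a k := u 0 (inord k) in let b k := v 0 (inord k) in
  \row_(k < 3) (if (k : nat) == 0%N then a 1%N * b 2%N - a 2%N * b 1%N
                else if (k : nat) == 1%N then a 2%N * b 0%N - a 0%N * b 2%N
                else a 0%N * b 1%N - a 1%N * b 0%N).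

Definition zmul (z w : 'rV[S]_8) : 'rV[S]_8 :=
  zmk (zA1 z * zA1 w - dot3 (zU z) (zX w))
      (- dot3 (zX z) (zU w) + zA2 z * zA2 w)
      (zA1 z *: zU w + zA2 w *: zU z + cross3 (zX z) (zX w))
      (zA1 w *: zX z + zA2 z *: zX w + cross3 (zU z) (zU w)).

Definition zone : 'rV[S]_8 := zmk 1 1 0 0.

Definition Zor : naalg S := @NAAlg S 'rV[S]_8 zmul zone.

Definition zor_norm (z : 'rV[S]_8) : S := zA1 z * zA2 z + dot3 (zU z) (zX z).
Definition zor_trace (z : 'rV[S]_8) : S := zA1 z + zA2 z.

Definition tau_zor (z w : 'rV[S]_8) : S := zor_trace (zmul z w).

End Zorn.

Definition in_centroid (R : pzRingType) (B : naalg R) (f : B -> B) : Prop :=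
  is_lin f /\ forall a b : B,
    f (na_mul B a b) = na_mul B (f a) b /\ f (na_mul B a b) = na_mul B a (f b).

Definition central (R : pzRingType) (B : naalg R) : Prop :=
  (forall r : R, (forall b : B, r *: b = 0) -> r = 0) /\
  (forall f : B -> B, in_centroid f -> exists r : R, forall b, f b = r *: b).

Definition in_span (R : pzRingType) (M : lmodType R) (P : M -> Prop) (x : M) : Prop :=
  exists (k : nat) (c : 'I_k -> R) (v : 'I_k -> M),
    (forall j, P (v j)) /\ x = \sum_(j < k) c j *: v j.

Definition associator (R : pzRingType) (B : naalg R) (a b c : B) : B :=
  na_mul B (na_mul B a b) c - na_mul B a (na_mul B b c).

Definition commutator (R : pzRingType) (B : naalg R) (a b : B) : B :=
  na_mul B a b - na_mul B b a.

Definition assocs (R : pzRingType) (B : naalg R) : B -> Prop :=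
  in_span (fun y => exists a b c, y = associator a b c).
Definition comms (R : pzRingType) (B : naalg R) : B -> Prop :=
  in_span (fun y => exists a b, y = commutator a b).

Definition in_sum (R : pzRingType) (M : lmodType R) (P Q : M -> Prop) (x : M) : Prop :=
  exists y z, P y /\ Q z /\ x = y + z.

Definition invariant_form (R : pzRingType) (B : naalg R) (beta : B -> B -> R) : Prop :=
  forall a b c : B,
    beta (na_mul B a b) c = beta a (na_mul B b c) /\
    beta a (na_mul B b c) = beta b (na_mul B c a).

Definition aut_invariant (R : comPzRingType) (B : naalg R) (beta : B -> B -> R) : Prop :=
  forall (S : comAlgType R) (BS : naalg S) (i : B -> BS) (betaS : BS -> BS -> S),
    is_alg_base_change i -> is_form_base_change i beta betaS ->
    forall phi : BS -> BS, is_alg_iso phi ->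
      forall u v, betaS (phi u) (phi v) = betaS u v.

(* beta coincides with the descended form tau_B: for every faithfully flat S
   and every splitting theta : B (x)_R S ~ Zor(S), beta_S = theta^*(tau_Zor(S)) *)
Definition is_descended_tau (R : comPzRingType) (B : naalg R) (beta : B -> B -> R) : Prop :=
  forall (S : comAlgType R) (BS : naalg S) (i : B -> BS) (theta : BS -> Zor S),
    faithfully_flat S -> is_alg_base_change i -> is_alg_iso theta ->
    is_form_base_change i beta (fun u v => tau_zor (theta u) (theta v)).

(* (Q, pi) is IBF_R(B): the quotient of B (x)_R B by the span of
   ab (x) c - a (x) bc and ab (x) c - b (x) ca, i.e. the universal
   R-bilinear map B x B -> Q satisfying these relations *)
Definition ibf_relations (R : pzRingType) (B : naalg R) (N : lmodType R)
  (pi : B -> B -> N) : Prop :=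
  forall a b c : B,
    pi (na_mul B a b) c = pi a (na_mul B b c) /\
    pi (na_mul B a b) c = pi b (na_mul B c a).

Definition is_IBF (R : pzRingType) (B : naalg R) (Q : lmodType R) (pi : B -> B -> Q) : Prop :=
  is_bilin_map pi /\ ibf_relations pi /\
  forall (N : lmodType R) (beta : B -> B -> N),
    is_bilin_map beta -> ibf_relations beta ->
    (exists g : Q -> N, is_lin g /\ forall x y, g (pi x y) = beta x y) /\
    (forall g g' : Q -> N, is_lin g -> is_lin g' ->
       (forall x y, g (pi x y) = g' (pi x y)) -> forall q, g q = g' q).

Definition IBF_principle (R : pzRingType) (B : naalg R) (beta : B -> B -> R) : Prop :=
  forall (Q : lmodType R) (pi : B -> B -> Q), is_IBF pi ->
    forall g : Q -> R, is_lform g -> (forall x y, g (pi x y) = beta x y) ->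
      bijective g.

(* Main.v *)
(* The identities of composition algebras reduce everything to one claim: an
   element of trace 0 is a combination of commutators, and also of associators.
   The ideal of those r which carry all trace 0 elements into one of these spans
   is shown to lie in no maximal ideal m.  As B has dimension 8 over the residue
   field of m, one finds h with disc h = t(h)^2 - 4 n(h) outside m, then v
   orthogonal to H = <1, h> and w orthogonal to Q = <1, h, v, hv> with n(v), n(w)
   outside m: a Cayley-Dickson doubling at m.  With e = 2h - t(h) one has
   [h, ey] = disc(h) y for y orthogonal to H, [v, hv] = n(v) e,
   (a, w, pw) = n(w) [p, a] for a, p in Q, and
   (h, v, [h, v]w') = disc(h) n(v) w' for w' orthogonal to Q, which is enough.

   Centrality and the IBF-principle follow because a linear map vanishing on
   commutators is a multiple of the trace.  The trace is determined by
   t(1) = 2 and x^2 - t(x) x in S 1, in any base change and without faithful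
   flatness; this gives invariance under automorphisms and descent. *)

From HB Require Import structures.
Require Import Defs.
From mathcomp Require Import all_boot all_algebra.
From mathcomp Require Import boolp classical_sets.
From mathcomp Require Import ring zify.
Set Implicit Arguments.
Unset Strict Implicit.
Unset Printing Implicit Defensive.
Import GRing.Theory.
Local Open Scope ring_scope.
Local Open Scope quotient_scope.

(** * Maximal ideals and residue fields *)

Definition is_ideal (R : comPzRingType) (J : R -> Prop) : Prop :=
  [/\ J 0, forall x y, J x -> J y -> J (x + y) & forall r x, J x -> J (r * x)].

(** Maximality is stated as invertibility modulo the ideal, the form that yields primality and the
    residue field. *)
Record maximal_ideal (R : comPzRingType) := MaximalIdeal {
  maxid_mem :> R -> Prop;
  maxid_ideal : is_ideal maxid_mem;
  maxid_proper : ~ maxid_mem 1;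
  maxid_inv : forall x, ~ maxid_mem x -> exists y, maxid_mem (1 - x * y) }.

Lemma maximal_ideal_above (R : comPzRingType) (J : R -> Prop) :
  is_ideal J -> ~ J 1 -> exists m : maximal_ideal R, forall x, J x -> m x.
Proof.
move=> [J0 JD JM] J1.
(* Quantifying over [A] with [A `|` J] a proper ideal makes the union of the
   empty chain admissible. *)
pose P (A : set R) := is_ideal (A `|` J)%classic /\ ~ (A `|` J)%classic 1.
have [F FP Ftot|A [[[A0 AD AM] A1] Amax]] := @Zorn_bigcup R P.
  split; last by case=> [[X FX X1]|//]; case: (FP X FX) => _; apply; left.
  split; first by right.
    move=> x y [[X FX Xx]|Jx] [[Y FY Yy]|Jy]; last by right; apply: JD.
    - have [Z [FZ [Zx Zy]]] : exists Z, F Z /\ Z x /\ Z y.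
        by case: (Ftot X Y FX FY) => [XY|YX];
          [exists Y|exists X]; do !split=> //; [apply: XY|apply: YX].
      have [[_ ZD _] _] := FP Z FZ.
      case: (ZD x y) => [||Zxy|]; [by left|by left| |by right].
      by left; exists Z.
    - have [[_ XD _] _] := FP X FX.
      case: (XD x y) => [||Xxy|]; [by left|by right| |by right].
      by left; exists X.
    - have [[_ YD _] _] := FP Y FY.
      case: (YD x y) => [||Yxy|]; [by right|by left| |by right].
      by left; exists Y.
  move=> r x [[X FX Xx]|Jx]; last by right; apply: JM.
  have [[_ _ XM] _] := FP X FX.
  case: (XM r x) => [|Xrx|]; [by left| |by right].
  by left; exists X.
have Ainv x : ~ (A `|` J)%classic x -> exists y, (A `|` J)%classic (1 - x * y).
  (* [N] is the sum of the ideal [A] union [J] and the multiples of [x]; by maximality of [A] it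
     cannot be proper. *)
  move=> Ax; pose N := [set z | exists a r, (A `|` J)%classic a /\ z = a + r * x]%classic.
  have AN z : (A `|` J)%classic z -> N z.
    by move=> Az; exists z, 0; rewrite mul0r addr0.
  have NJ : (N `|` J)%classic = N.
    by apply/seteqP; split=> z; [case=> // Jz; apply: AN; right|left].
  have Nid : is_ideal N.
    split; first exact: AN.
      move=> _ _ [a [r [Aa ->]]] [b [s [Ab ->]]].
      by exists (a + b), (r + s); split; [apply: AD|rewrite mulrDl addrACA].
    move=> c _ [a [r [Aa ->]]]; exists (c * a), (c * r).
    by split; [apply: AM|rewrite mulrDr mulrA].
  have /Amax PN : (A `<` N)%classic.
    split=> [z Az|]; first by apply: AN; left.
    move=> NA; apply: Ax; left; apply: NA.
    by exists 0, 1; rewrite mul1r add0r.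
  have [a [r [Aa E]]] : N 1 by apply: contrapT => N1; apply: PN; split; rewrite NJ.
  by exists r; rewrite E mulrC addrK.
exists (MaximalIdeal (And3 A0 AD AM) A1 Ainv) => x Jx; by right.
Qed.

(** Applied below to ideals of scalars that make an assertion true after multiplication: the
    assertion itself follows once each maximal ideal misses one such scalar. *)
Lemma ideal_local_global (R : comPzRingType) (J : R -> Prop) : is_ideal J ->
  (forall m : maximal_ideal R, exists r, J r /\ ~ m r) -> J 1.
Proof.
move=> Jid Jloc; apply: contrapT => J1.
have [m Jm] := maximal_ideal_above Jid J1.
by have [r [/Jm]] := Jloc m.
Qed.

Section MaximalIdealTheory.
Variables (R : comPzRingType) (m : maximal_ideal R).

Lemma maxid0 : m 0. Proof. by case: (maxid_ideal m). Qed.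
Lemma maxidD x y : m x -> m y -> m (x + y).
Proof. by case: (maxid_ideal m) => _ mD _; apply: mD. Qed.
Lemma maxidMl r x : m x -> m (r * x).
Proof. by case: (maxid_ideal m) => _ _ mM; apply: mM. Qed.
Lemma maxidMr r x : m x -> m (x * r).
Proof. by rewrite mulrC; apply: maxidMl. Qed.
Lemma maxidN x : m x -> m (- x).
Proof. by move=> mx; rewrite -mulN1r; apply: maxidMl. Qed.
Lemma maxidB x y : m x -> m y -> m (x - y).
Proof. by move=> mx my; apply: maxidD => //; apply: maxidN. Qed.

Lemma maxid_prime x y : ~ m x -> ~ m y -> ~ m (x * y).
Proof.
move=> /(maxid_inv (m:=m)) [z mz] my mxy; apply: my.
rewrite (_ : y = y * (1 - x * z) + z * (x * y)); last first.
  by rewrite mulrBr mulr1 [x * z]mulrC mulrCA [y * _]mulrC mulrA subrK.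
by apply: maxidD; apply: maxidMl.
Qed.

Lemma maxid_prime_mul x y : m (x * y) -> ~ m x -> m y.
Proof. by move=> mxy mx; apply: contrapT => my; apply: (maxid_prime mx my). Qed.

Lemma maxid_expN x k : ~ m x -> ~ m (x ^+ k).
Proof.
move=> mx; elim: k => [|k IH]; first by rewrite expr0; apply: maxid_proper.
by rewrite exprS; apply: maxid_prime.
Qed.

Definition maxid_pred : {pred R} := fun x => `[< m x >].

Fact maxid_zmod_closed : zmod_closed maxid_pred.
Proof.
split=> [|x y]; first by apply/asboolP; apply: maxid0.
by move=> /asboolP mx /asboolP my; apply/asboolP; apply: maxidB.
Qed.
HB.instance Definition _ := GRing.isZmodClosed.Build R maxid_pred maxid_zmod_closed.

Definition residue := Quotient.quot maxid_pred.
HB.instance Definition _ := GRing.Zmodule.on residue.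

Definition to_residue (x : R) : residue := \pi_(Quotient.quot maxid_pred) x.

Lemma to_residue_eq x y : to_residue x = to_residue y <-> m (x - y).
Proof.
split.
  by move=> /eqP; rewrite -[_ == _]/(_ == _ %[mod Quotient.quot maxid_pred])
    -Quotient.idealrBE => /asboolP.
move=> mxy; apply/eqP; rewrite -[_ == _]/(_ == _ %[mod Quotient.quot maxid_pred]).
by rewrite -Quotient.idealrBE; apply/asboolP.
Qed.

Lemma to_residue_surj (u : residue) : exists x, u = to_residue x.
Proof. by exists (repr u); rewrite /to_residue reprK. Qed.

Lemma to_residueD x y : to_residue (x + y) = to_residue x + to_residue y.
Proof. by rewrite /to_residue raddfD. Qed.
Lemma to_residue0 : to_residue 0 = 0.
Proof. by rewrite /to_residue raddf0. Qed.

(** The product is taken on representatives; independence of the choice is [residue_mulE]. *)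
Definition residue_mul (u v : residue) := to_residue (repr u * repr v).

Lemma residue_mulE x y : residue_mul (to_residue x) (to_residue y) = to_residue (x * y).
Proof.
have Hr z : m (repr (to_residue z) - z).
  by apply/to_residue_eq; rewrite /to_residue reprK.
apply/to_residue_eq.
rewrite (_ : _ - _ = repr (to_residue y) * (repr (to_residue x) - x)
                     + x * (repr (to_residue y) - y)); last by ring.
by apply: maxidD; apply: maxidMl.
Qed.

Fact residue_mulA : associative residue_mul.
Proof.
move=> u v w; have [x ->] := to_residue_surj u; have [y ->] := to_residue_surj v.
by have [z ->] := to_residue_surj w; rewrite !residue_mulE mulrA.
Qed.
Fact residue_mulC : commutative residue_mul.
Proof.
move=> u v; have [x ->] := to_residue_surj u; have [y ->] := to_residue_surj v.
by rewrite !residue_mulE mulrC.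
Qed.
Fact residue_mul1 : left_id (to_residue 1) residue_mul.
Proof. by move=> u; have [x ->] := to_residue_surj u; rewrite residue_mulE mul1r. Qed.
Fact residue_mulD : left_distributive residue_mul +%R.
Proof.
move=> u v w; have [x ->] := to_residue_surj u; have [y ->] := to_residue_surj v.
have [z ->] := to_residue_surj w; rewrite -to_residueD !residue_mulE.
by rewrite mulrDl to_residueD.
Qed.
Fact residue_neq0 : to_residue 1 != 0.
Proof.
by apply/eqP; rewrite -to_residue0 => /to_residue_eq; rewrite subr0; apply: maxid_proper.
Qed.
HB.instance Definition _ := GRing.Zmodule_isComNzRing.Build residue
  residue_mulA residue_mulC residue_mul1 residue_mulD residue_neq0.

Definition residue_scale (r : R) (u : residue) : residue := to_residue r * u.

Lemma to_residueM x y : to_residue (x * y) = to_residue x * to_residue y.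
Proof. by rewrite -residue_mulE. Qed.

Fact residue_scaleA a b v : residue_scale a (residue_scale b v) = residue_scale (a * b) v.
Proof. by rewrite /residue_scale mulrA -to_residueM. Qed.
Fact residue_scale1 : left_id 1 residue_scale.
Proof. by move=> u; rewrite /residue_scale mul1r. Qed.
Fact residue_scaleDr : right_distributive residue_scale +%R.
Proof. by move=> r u v; rewrite /residue_scale mulrDr. Qed.
Fact residue_scaleDl v : {morph residue_scale^~ v : a b / a + b}.
Proof. by move=> a b; rewrite /residue_scale to_residueD mulrDl. Qed.
HB.instance Definition _ := GRing.Zmodule_isLmodule.Build R residue
  residue_scaleA residue_scale1 residue_scaleDr residue_scaleDl.

Fact residue_scaleAl a (u v : residue) : a *: (u * v) = (a *: u) * v.
Proof. exact: mulrA. Qed.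
Fact residue_scaleAr a (u v : residue) : a *: (u * v) = u * (a *: v).
Proof. exact: mulrCA. Qed.
HB.instance Definition _ := GRing.Lmodule_isLalgebra.Build R residue residue_scaleAl.
HB.instance Definition _ := GRing.Lalgebra_isAlgebra.Build R residue residue_scaleAr.

Lemma residue_algE (r : R) : r%:A = to_residue r :> residue.
Proof. exact: mulr1. Qed.

Lemma residue_field : is_field_alg residue.
Proof.
split; first exact: oner_neq0.
move=> u; have [x ->] := to_residue_surj u => u0.
have [|y mxy] := @maxid_inv _ m x.
  move=> mx; case/eqP: u0; rewrite -to_residue0; apply/to_residue_eq.
  by rewrite subr0.
exists (to_residue y); rewrite -to_residueM; symmetry; exact/to_residue_eq.
Qed.

End MaximalIdealTheory.

(** * Base change of projective modules *)

Section LinearMaps.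
Variables (R : pzRingType) (M N : lmodType R) (f : M -> N).
Hypothesis flin : is_lin f.

Lemma lin0 : f 0 = 0.
Proof.
by have := flin (-1) 0 0; rewrite scaler0 addr0 scaleN1r addNr.
Qed.
Lemma linD x y : f (x + y) = f x + f y.
Proof. by have := flin 1 x y; rewrite !scale1r. Qed.
Lemma linZ r x : f (r *: x) = r *: f x.
Proof. by have := flin r x 0; rewrite !addr0 lin0 addr0. Qed.
Lemma linN x : f (- x) = - f x.
Proof. by rewrite -scaleN1r linZ scaleN1r. Qed.
Lemma linB x y : f (x - y) = f x - f y.
Proof. by rewrite linD linN. Qed.
Lemma lin_sum (I : Type) (r : seq I) (P : pred I) (F : I -> M) :
  f (\sum_(i <- r | P i) F i) = \sum_(i <- r | P i) f (F i).
Proof. by apply: (big_morph f linD lin0). Qed.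
End LinearMaps.

Section LinearForms.
Variables (R : pzRingType) (M : lmodType R) (f : M -> R).
Hypothesis flin : is_lform f.

Let flin' : is_lin (f : M -> R^o). Proof. exact: flin. Qed.
Lemma lform0 : f 0 = 0. Proof. exact: (lin0 flin'). Qed.
Lemma lformD x y : f (x + y) = f x + f y. Proof. exact: (linD flin'). Qed.
Lemma lformZ r x : f (r *: x) = r * f x. Proof. exact: (linZ flin'). Qed.
Lemma lformN x : f (- x) = - f x. Proof. exact: (linN flin'). Qed.
Lemma lform_sum (I : Type) (r : seq I) (P : pred I) (F : I -> M) :
  f (\sum_(i <- r | P i) F i) = \sum_(i <- r | P i) f (F i).
Proof. exact: (lin_sum flin'). Qed.
End LinearForms.

Section SemilinearMaps.
Variables (R : comPzRingType) (S : comAlgType R) (M : lmodType R) (N : lmodType S).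
Variables (f : M -> N).
Hypothesis flin : is_semilin f.

Lemma semilin0 : f 0 = 0.
Proof.
by have := flin (-1) 0 0; rewrite scaler0 addr0 !scaleN1r addNr.
Qed.
Lemma semilinD x y : f (x + y) = f x + f y.
Proof. by have := flin 1 x y; rewrite !scale1r. Qed.
Lemma semilinZ r x : f (r *: x) = (r%:A : S) *: f x.
Proof. by have := flin r x 0; rewrite !addr0 semilin0 addr0. Qed.
Lemma semilinN x : f (- x) = - f x.
Proof. by rewrite -scaleN1r semilinZ scaleN1r scaleN1r. Qed.
Lemma semilinB x y : f (x - y) = f x - f y.
Proof. by rewrite semilinD semilinN. Qed.
Lemma semilin_sum (I : Type) (r : seq I) (P : pred I) (F : I -> M) :
  f (\sum_(i <- r | P i) F i) = \sum_(i <- r | P i) f (F i).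
Proof. by apply: (big_morph f semilinD semilin0). Qed.
End SemilinearMaps.

Lemma fg_projective_dual_basis (R : pzRingType) (M : lmodType R) : fg_projective M ->
  exists (k : nat) (b : 'I_k -> M) (s : 'I_k -> M -> R),
    (forall j, is_lform (s j)) /\ forall x, x = \sum_j s j x *: b j.
Proof.
move=> [k [p [s [plin [slin ps]]]]].
exists k, (fun j => p (delta_mx 0 j)), (fun j x => s x 0 j); split.
  by move=> j r x y; rewrite slin !mxE.
move=> x; rewrite -{1}[x]ps {1}[s x]row_sum_delta (lin_sum plin).
by apply: eq_bigr => j _; rewrite (linZ plin).
Qed.

(** For a dual basis [b], [s], the matrix of all [s j (b i)] is idempotent, and its fixed rows over
    [S] form a concrete model of the base change. *)
Section FixedRows.
Variables (S : comPzRingType) (k : nat) (E : 'M[S]_k).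
Definition fixed_rows : {pred 'rV[S]_k} := fun v => v *m E == v.
Fact fixed_rows_submod : submod_closed fixed_rows.
Proof.
split=> [|a u v /eqP uE /eqP vE]; apply/eqP; first by rewrite mul0mx.
by rewrite mulmxDl -scalemxAl uE vE.
Qed.
HB.instance Definition _ :=
  GRing.isSubmodClosed.Build S 'rV[S]_k fixed_rows fixed_rows_submod.
Definition fixed_row_space := {v : 'rV[S]_k | v \in fixed_rows}.
HB.instance Definition _ := SubChoice.on fixed_row_space.
HB.instance Definition _ := [SubChoice_isSubLmodule of fixed_row_space by <:].
End FixedRows.

Lemma base_change_exists (R : comPzRingType) (S : comAlgType R) (M : lmodType R) :
  fg_projective M -> exists (MS : lmodType S) (i : M -> MS), is_base_change i.
Proof.
move=> /fg_projective_dual_basis [k [b [s [slin sb]]]].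
pose E : 'M[S]_k := \matrix_(i, j) (s j (b i))%:A.
pose row x : 'rV[S]_k := \row_j (s j x)%:A.
have rowE x : row x \in fixed_rows E.
  apply/eqP/rowP => j; rewrite !mxE {2}(sb x) (lform_sum (slin j)) scaler_suml.
  apply: eq_bigr => i _; rewrite !mxE (lformZ (slin j)) mulr_algl.
  by rewrite scalerA.
pose i x : fixed_row_space E := exist _ (row x) (rowE x).
exists (fixed_row_space E : lmodType S), i; split.
  move=> r x y; apply/val_inj/rowP => j.
  by rewrite linearP !mxE slin mulr_algl scalerDl scalerA.
move=> N f flin; split.
  exists (fun v : fixed_row_space E => \sum_j (val v) 0 j *: f (b j)); split.
    move=> r u v; rewrite linearP scaler_sumr -big_split /=.
    by apply: eq_bigr => j _; rewrite !mxE scalerDl scalerA.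
  move=> x; rewrite [in RHS](sb x) (semilin_sum flin).
  by apply: eq_bigr => j _; rewrite (semilinZ flin) mxE.
move=> g g' glin g'lin gg' v.
(* Being fixed by [E] says exactly that [v] is the combination of the [i (b j)] with its own
   coordinates; this gives uniqueness. *)
have -> : v = \sum_j (val (v : fixed_row_space E)) 0 j *: i (b j).
  apply: val_inj; rewrite linear_sum /=; apply/rowP => l; rewrite summxE.
  have /eqP {1}<- : val v *m E == val v by have := valP v.
  by rewrite mxE; apply: eq_bigr => j _; rewrite !mxE.
rewrite (lin_sum glin) (lin_sum g'lin); apply: eq_bigr => j _.
by rewrite (linZ glin) (linZ g'lin) gg'.
Qed.

Lemma base_change_form (R : comPzRingType) (S : comAlgType R) (M : lmodType R)
    (MS : lmodType S) (i : M -> MS) (f : M -> R) :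
  is_base_change i -> is_lform f ->
  exists g : MS -> S, is_lform g /\ forall m, g (i m) = (f m)%:A.
Proof.
move=> [ilin iU] flin; have [|[g [glin gi]] _] := iU S^o (fun m => (f m)%:A : S).
  move=> r x y; rewrite flin scalerDl -scalerA; congr (_ + _).
  by rewrite -[RHS]/((r%:A : S) * ((f x)%:A : S)) mulr_algl.
by exists g.
Qed.

Lemma base_change_dual_basis (R : comPzRingType) (S : comAlgType R) (M : lmodType R)
    (MS : lmodType S) (i : M -> MS) : is_base_change i -> fg_projective M ->
  exists (k : nat) (b : 'I_k -> M) (h : 'I_k -> MS -> S),
    (forall j, is_lform (h j)) /\ forall z, z = \sum_j h j z *: i (b j).
Proof.
move=> iB /fg_projective_dual_basis [k [b [s [slin sb]]]].
have /choice [h hP] : forall j, exists g : MS -> S, is_lform g /\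
    forall m, g (i m) = (s j m)%:A.
  by move=> j; apply: base_change_form.
exists k, b, h; split; first by move=> j; case: (hP j).
(* The identity and the dual basis expansion are both linear extensions of [i], hence equal. *)
have [ilin iU] := iB; have [_ unq] := iU MS i ilin.
apply: (unq id (fun z => \sum_j h j z *: i (b j))).
- by [].
- move=> r x y; rewrite scaler_sumr -big_split; apply: eq_bigr => j _ /=.
  by have [hl _] := hP j; rewrite hl scalerDl scalerA.
- move=> m; rewrite {1}(sb m) (semilin_sum ilin); apply: eq_bigr => j _.
  by have [_ ->] := hP j; rewrite (semilinZ ilin).
Qed.

(** Padding [A] and [C] with zeros to square matrices keeps the product 1, but the padded [C] has a
    zero row and so determinant 0. *)
Lemma mulmx1_narrow (S : comPzRingType) (d r : nat) (A : 'M[S]_(d, r)) (C : 'M[S]_(r, d)) :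
  (r < d)%N -> A *m C = 1%:M -> (1 : S) = 0.
Proof.
move=> rd AC; have dE : d = (r + (d - r).-1.+1)%N by lia.
move: (d - r).-1 dE => q dE; subst d.
have : \det (row_mx A 0 *m col_mx C (0 : 'M[S]_(q.+1, _))) = 1.
  by rewrite mul_row_col mul0mx addr0 AC det1.
rewrite det_mulmx => <-.
suff -> : \det (col_mx C (0 : 'M[S]_(q.+1, _))) = 0 by rewrite mulr0.
rewrite (expand_det_row _ (rshift r 0)) big1 // => j _.
by rewrite col_mxEd mxE mul0r.
Qed.

(* Some [z] is not in the span of the [x j] over the residue field of [m]. *)
Lemma rank_bound (R : comPzRingType) (M : lmodType R) (d r : nat)
    (m : maximal_ideal R) (a : R) (x : 'I_r -> M) :
  proj_const_rank M d -> (r < d)%N -> ~ m a ->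
  exists z : M, forall c : 'I_r -> R, exists f : M -> R,
    is_lform f /\ ~ m (f (a *: z - \sum_j c j *: x j)).
Proof.
move=> [Mproj Mrank] rd ma; apply: contrapT => noz.
(* If the claim fails, every [a *: z] is a combination of the [x j] modulo [m], as tested by all
   linear forms. The factor [a] lets callers use projections with denominators cleared. *)
have small z : exists c : 'I_r -> R, forall f : M -> R,
    is_lform f -> m (f (a *: z - \sum_j c j *: x j)).
  apply: contrapT => noc; apply: noz; exists z => c.
  apply: contrapT => nof; apply: noc; exists c => f flin.
  by apply: contrapT => mf; apply: nof; exists f.
have [MK [i iB]] := base_change_exists (residue m) Mproj.
have [ilin _] := iB.
have [e [efree espan]] := Mrank _ _ _ (residue_field m) iB.
have [k [b [s [slin sb]]]] := fg_projective_dual_basis Mproj.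
have [a' a'E] : exists a' : residue m, a' * to_residue m a = 1.
  have [_ inv] := residue_field m.
  have [|a' E] := inv (to_residue m a); last by exists a'; rewrite mulrC.
  apply/eqP => /= E; apply: ma; rewrite -[a]subr0; apply/to_residue_eq.
  by rewrite E to_residue0.
have ispan z : exists c : 'I_r -> residue m, i z = \sum_j c j *: i (x j).
  have [c cP] := small z; exists (fun j => a' * to_residue m (c j)).
  have i0 y : (forall f, is_lform f -> m (f y)) -> i y = 0.
    move=> fy; rewrite (sb y) (semilin_sum ilin) big1 // => j _.
    rewrite (semilinZ ilin) residue_algE.
    have -> : to_residue m (s j y) = 0.
      by rewrite -to_residue0; apply/to_residue_eq; rewrite subr0; apply: fy.
    by rewrite scale0r.
  have /eqP := i0 _ cP; rewrite (semilinB ilin) subr_eq0 => /eqP.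
  rewrite (semilinZ ilin) residue_algE (semilin_sum ilin) => /(congr1 (GRing.scale a')).
  rewrite scalerA a'E scale1r scaler_sumr => ->.
  by apply: eq_bigr => j _; rewrite (semilinZ ilin) residue_algE scalerA.
have xspan z : exists c : 'I_r -> residue m, z = \sum_j c j *: i (x j).
  have [l [w [c [_ wP]]]] := base_change_dual_basis iB Mproj.
  rewrite (wP z); have /choice [C CP] := fun j => ispan (w j).
  exists (fun q => \sum_j c j z * C j q).
  under [RHS]eq_bigr do rewrite scaler_suml.
  rewrite exchange_big; apply: eq_bigr => j _.
  rewrite CP scaler_sumr; apply: eq_bigr => q _; by rewrite scalerA.
have /choice [A AP] := fun j => xspan (e j).
have /choice [C CP] := fun j => espan (i (x j)).
pose mA : 'M[residue m]_(d, r) := \matrix_(p, q) A p q.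
pose mC : 'M[residue m]_(r, d) := \matrix_(p, q) C p q.
(* The [d] basis vectors [e] are expressed through the [r] vectors [i (x j)] and back, so freeness
   makes the composite the identity. *)
have AC : mA *m mC = 1%:M.
  apply/matrixP => p q; apply/eqP; rewrite -subr_eq0; apply/eqP.
  apply: (efree (fun q => (mA *m mC) p q - 1%:M p q)).
  have idE : \sum_j (1%:M : 'M[residue m]_d) p j *: e j = e p.
    rewrite (bigD1 p) //= mxE eqxx scale1r big1 ?addr0 // => j jp.
    by rewrite mxE eq_sym (negbTE jp) scale0r.
  under eq_bigr do rewrite scalerBl.
  rewrite sumrB idE [X in _ - X]AP; apply/eqP; rewrite subr_eq0; apply/eqP.
  under eq_bigr do rewrite mxE scaler_suml.
  rewrite exchange_big; apply: eq_bigr => j _.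
  rewrite CP scaler_sumr; apply: eq_bigr => l _; by rewrite scalerA !mxE.
by have /eqP := mulmx1_narrow rd AC; rewrite oner_eq0.
Qed.

(** * Identities of composition algebras *)

(** Reduces a consequence of a known equation to an identity that [ring] can check. *)
Lemma eq_of_sub (V : zmodType) (a b c d : V) : c = d -> a - b = c - d -> a = b.
Proof. by move=> ->; rewrite subrr => /eqP; rewrite subr_eq0 => /eqP. Qed.

Section CompositionIdentities.
Variables (R : comPzRingType) (B : naalg R) (n : B -> R).
Hypothesis octB : is_octonion n.

Local Notation "x ** y" := (na_mul B x y) (at level 40, left associativity).
Local Notation e1 := (na_one B).
Local Notation bf := (polar n).
Local Notation t := (trace n).
Local Notation conj x := (t x *: e1 - x).

Lemma na_mulDl x y z : (x + y) ** z = x ** z + y ** z.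
Proof. by case: octB => [[[ml _] _] _]; apply: linD (ml z) x y. Qed.
Lemma na_mulDr x y z : x ** (y + z) = x ** y + x ** z.
Proof. by case: octB => [[[_ mr] _] _]; apply: linD (mr x) y z. Qed.
Lemma na_mulZl r x y : (r *: x) ** y = r *: (x ** y).
Proof. by case: octB => [[[ml _] _] _]; apply: linZ (ml y) r x. Qed.
Lemma na_mulZr r x y : x ** (r *: y) = r *: (x ** y).
Proof. by case: octB => [[[_ mr] _] _]; apply: linZ (mr x) r y. Qed.
Lemma na_mulNl x y : (- x) ** y = - (x ** y).
Proof. by rewrite -scaleN1r na_mulZl scaleN1r. Qed.
Lemma na_mulNr x y : x ** (- y) = - (x ** y).
Proof. by rewrite -scaleN1r na_mulZr scaleN1r. Qed.
Lemma na_mul1l x : e1 ** x = x.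
Proof. by case: octB => [[_ m1] _]; case: (m1 x). Qed.
Lemma na_mul1r x : x ** e1 = x.
Proof. by case: octB => [[_ m1] _]; case: (m1 x). Qed.
Definition na_mulE := (na_mulDl, na_mulDr, na_mulZl, na_mulZr, na_mulNl, na_mulNr,
  na_mul1l, na_mul1r).

Lemma normZ r x : n (r *: x) = r ^+ 2 * n x.
Proof. by case: octB => [_ [_ [[nZ _] _]]]. Qed.
Lemma normM x y : n (x ** y) = n x * n y.
Proof. by case: octB => [_ [_ [_ [_ nM]]]]. Qed.
Lemma normD x y : n (x + y) = n x + n y + bf x y.
Proof. by rewrite /polar; ring. Qed.
Lemma polar_lin x : is_lform (bf x).
Proof. by case: octB => [_ [_ [[_ [_ nr]] _]]]; apply: nr. Qed.
Lemma polarC x y : bf x y = bf y x.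
Proof. by rewrite /polar (addrC x y); ring. Qed.
Lemma polarDr x y z : bf x (y + z) = bf x y + bf x z.
Proof. exact: lformD (polar_lin x) y z. Qed.
Lemma polarZr r x y : bf x (r *: y) = r * bf x y.
Proof. exact: lformZ (polar_lin x) r y. Qed.
Lemma polarNr x y : bf x (- y) = - bf x y.
Proof. exact: lformN (polar_lin x) y. Qed.
Lemma polarDl x y z : bf (x + y) z = bf x z + bf y z.
Proof. by rewrite polarC polarDr !(polarC z). Qed.
Lemma polarZl r x y : bf (r *: x) y = r * bf x y.
Proof. by rewrite polarC polarZr polarC. Qed.
Lemma polarNl x y : bf (- x) y = - bf x y.
Proof. by rewrite polarC polarNr polarC. Qed.
Lemma polar0r x : bf x 0 = 0.
Proof. exact: lform0 (polar_lin x). Qed.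
Lemma polar0l x : bf 0 x = 0.
Proof. by rewrite polarC polar0r. Qed.
Definition polarE := (polarDl, polarDr, polarZl, polarZr, polarNl, polarNr).

(** Equations in the nonassociative algebra are proved by pairing both sides with an arbitrary
    element, which moves the computation into [R]. *)
Lemma polar_inj x y : (forall z, bf x z = bf y z) -> x = y.
Proof. by case: octB => [_ [_ [_ [[ninj _] _]]]]; apply: ninj. Qed.
Lemma polar_surj f : is_lform f -> exists x, forall y, f y = bf x y.
Proof. by case: octB => [_ [_ [_ [[_ nsurj] _]]]]; apply: nsurj. Qed.

Lemma octonion_faithful r : (forall b : B, r *: b = 0) -> r = 0.
Proof.
move=> rB; pose J s := s * r = 0.
suff: J 1 by rewrite /J mul1r.
apply: ideal_local_global => [|m].
  split=> [|x y Jx Jy|s x Jx]; rewrite /J ?mul0r //.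
    by rewrite mulrDl Jx Jy addr0.
  by rewrite -mulrA Jx mulr0.
(* Positive rank at [m] gives [z] and a form [f] with [f z] outside [m], while
   [r * f z = f (r *: z) = 0]. *)
have [_ [Brank _]] := octB.
have [z /(_ (fun=> 0)) [f [flin]]] :=
  rank_bound (fun _ : 'I_0 => 0) Brank (isT : (0 < 8)%N) (maxid_proper (m:=m)).
rewrite big_ord0 subr0 scale1r => mfz; exists (f z); split=> //.
by rewrite /J mulrC -(lformZ flin) rB (lform0 flin).
Qed.

(** Multiplicativity makes [1 - n e1] kill every norm, hence every value of the polar form, hence
    [B], which is faithful. *)
Lemma norm1 : n e1 = 1.
Proof.
apply/eqP; rewrite eq_sym -subr_eq0; apply/eqP; apply: octonion_faithful => b.
apply: polar_inj => z.
have nE x : (1 - n e1) * n x = 0 by rewrite mulrBl mul1r -normM na_mul1l subrr.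
by rewrite polarZl polar0l /polar !mulrBr !nE !subrr.
Qed.

Lemma polar_diag x : bf x x = 2 * n x.
Proof.
by have := normZ 2 x; rewrite scaler_nat mulr2n normD => E; apply: (eq_of_sub E); ring.
Qed.
Lemma trace1 : t e1 = 2.
Proof. by rewrite /trace polar_diag norm1 mulr1. Qed.
Lemma traceD x y : t (x + y) = t x + t y. Proof. exact: polarDr. Qed.
Lemma traceZ r x : t (r *: x) = r * t x. Proof. exact: polarZr. Qed.
Lemma traceN x : t (- x) = - t x. Proof. exact: polarNr. Qed.
Definition traceE := (traceD, traceZ, traceN, trace1).
Lemma polar1l x : bf e1 x = t x. Proof. by []. Qed.
Lemma polar1r x : bf x e1 = t x. Proof. exact: polarC. Qed.

Lemma polar_mull x y z : bf (x ** y) (x ** z) = n x * bf y z.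
Proof. by rewrite /polar -na_mulDr !normM; ring. Qed.
Lemma polar_mulr x y z : bf (x ** y) (z ** y) = bf x z * n y.
Proof. by rewrite /polar -na_mulDl !normM; ring. Qed.
(** Linearization of [polar_mulr] in the right factor; putting one argument equal to the unit then
    makes conjugate multiplication the adjoint. *)
Lemma polar_mul4 x y z w :
  bf (x ** y) (z ** w) + bf (x ** w) (z ** y) = bf x z * bf y w.
Proof.
have := polar_mulr x (y + w) z; rewrite !na_mulDr !polarE !polar_mulr normD => E.
by apply: (eq_of_sub E); ring.
Qed.

Lemma polar_adjl x y z : bf (x ** y) z = bf y (conj x ** z).
Proof.
have := polar_mul4 x y e1 z; rewrite !na_mulE polar1r => E.
by rewrite !(na_mulE, polarE); apply: (eq_of_sub E); rewrite (polarC (x ** z)); ring.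
Qed.
Lemma polar_adjr x y z : bf (x ** y) z = bf x (z ** conj y).
Proof.
have := polar_mul4 x y z e1; rewrite !na_mulE polar1r => E.
by rewrite !(na_mulE, polarE); apply: (eq_of_sub E); ring.
Qed.

Lemma conj_mull x y : conj x ** (x ** y) = n x *: y.
Proof.
by apply: polar_inj => z; rewrite polarC -polar_adjl polar_mull polarZl (polarC y).
Qed.
Lemma conj_mulr x y : (x ** y) ** conj y = n y *: x.
Proof.
by apply: polar_inj => z; rewrite polarC -polar_adjr polar_mulr polarZl mulrC (polarC x).
Qed.

Lemma altl x y : x ** (x ** y) = t x *: (x ** y) - n x *: y.
Proof. by rewrite -conj_mull !na_mulE opprB addrC subrK. Qed.
Lemma altr x y : (x ** y) ** y = t y *: (x ** y) - n y *: x.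
Proof. by rewrite -conj_mulr !na_mulE opprB addrC subrK. Qed.
Lemma mul_self x : x ** x = t x *: x - n x *: e1.
Proof. by have := altl x e1; rewrite na_mul1r. Qed.

Lemma altl_lin x y z : x ** (y ** z) + y ** (x ** z) =
  t x *: (y ** z) + t y *: (x ** z) - bf x y *: z.
Proof.
apply: polar_inj => u; have /(congr1 (bf^~ u)) := altl (x + y) z.
rewrite !(na_mulE, polarE, traceE, normD, altl) => E.
by apply: (eq_of_sub E); ring.
Qed.
Lemma altr_lin x y z : (x ** y) ** z + (x ** z) ** y =
  t y *: (x ** z) + t z *: (x ** y) - bf y z *: x.
Proof.
apply: polar_inj => u; have /(congr1 (bf^~ u)) := altr x (y + z).
rewrite !(na_mulE, polarE, traceE, normD, altr) => E.
by apply: (eq_of_sub E); ring.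
Qed.
Lemma mul_anticomm x y : x ** y + y ** x = t x *: y + t y *: x - bf x y *: e1.
Proof. by have := altl_lin x y e1; rewrite !na_mul1r. Qed.

Lemma trace_mul x y : t (x ** y) = t x * t y - bf x y.
Proof. by rewrite -polar1r polar_adjl na_mul1r !polarE polar1r (polarC x). Qed.
Lemma trace_mulC x y : t (x ** y) = t (y ** x).
Proof. by rewrite !trace_mul polarC; ring. Qed.
Lemma trace_mul_conjl x y : t (x ** y) = bf (conj x) y.
Proof. by rewrite trace_mul polarDl polarZl polarNl. Qed.
Lemma trace_mul_conjr x y : t (x ** y) = bf x (conj y).
Proof. by rewrite trace_mul polarDr polarZr polarNr polar1r mulrC. Qed.
Lemma trace_mulA x y z : t ((x ** y) ** z) = t (x ** (y ** z)).
Proof.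
by rewrite trace_mul_conjr polar_adjl trace_mul_conjl [in RHS]polarC polar_adjr.
Qed.

Lemma polar_mul_selfl x y : bf x (x ** y) = n x * t y.
Proof. by rewrite -{1}[x]na_mul1r polar_mull. Qed.
Lemma polar_mul_selfr x y : bf x (y ** x) = n x * t y.
Proof. by rewrite -{1}[x]na_mul1l polar_mulr mulrC. Qed.

(** * Commutators and associators in a Cayley-Dickson doubling *)

Local Notation disc h := (t h ^+ 2 - 4 * n h).
Local Notation dbl h := (2 *: h - t h *: e1).

Lemma trace_dbl h : t (dbl h) = 0.
Proof. by rewrite !traceE; ring. Qed.
Lemma norm_dbl h : n (dbl h) = - disc h.
Proof.
by rewrite -scaleNr normD !normZ norm1 polarZl polarZr polar1r; ring.
Qed.
Lemma mul_dbl h y : dbl h ** (dbl h ** y) = disc h *: y.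
Proof. by rewrite altl trace_dbl norm_dbl scale0r add0r scaleNr opprK. Qed.

Lemma perp_mull h y : t y = 0 -> bf h y = 0 -> t (h ** y) = 0 /\ bf h (h ** y) = 0.
Proof. by move=> ty hy; rewrite trace_mul polar_mul_selfl ty hy !mulr0 subr0. Qed.

(** For such [y] the linearized quadratic equation reduces to [h ** y + y ** h = t h *: y]. *)
Lemma commutator_perp h y : t y = 0 -> bf h y = 0 -> commutator h y = dbl h ** y.
Proof.
move=> ty hy; have := mul_anticomm h y; rewrite ty hy !scale0r subr0 addr0 => E.
apply: polar_inj => z; move/(congr1 (bf^~ z)): E.
by rewrite /commutator !(na_mulE, polarE) => E; apply: (eq_of_sub (esym E)); ring.
Qed.

Lemma commutator_dbl_mul h y : t y = 0 -> bf h y = 0 ->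
  commutator h (dbl h ** y) = disc h *: y.
Proof.
move=> ty hy; have [thy hhy] := perp_mull ty hy.
by rewrite commutator_perp ?mul_dbl // !(na_mulE, polarE, traceE)
  ?(ty, hy, thy, hhy); ring.
Qed.

Lemma mul_perp_swap h v : t v = 0 -> bf h v = 0 ->
  v ** (h ** v) = n v *: h - (t h * n v) *: e1.
Proof.
move=> tv hv; have := altl_lin v h v.
rewrite mul_self tv polarC hv !na_mulE => E.
apply: polar_inj => z; move/(congr1 (bf^~ z)): E.
by rewrite !(na_mulE, polarE) => E; apply: (eq_of_sub E); ring.
Qed.

Lemma commutator_perp_mul h v : t v = 0 -> bf h v = 0 ->
  commutator v (h ** v) = n v *: dbl h.
Proof.
move=> tv hv; rewrite /commutator mul_perp_swap // altr tv.
by apply: polar_inj => z; rewrite !polarE; ring.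
Qed.

(** The Cayley-Dickson rule b(aw) = (ab)w: both sides complete (aw)b to t(b) aw, one by
    [mul_anticomm], the other by [altr_lin]. *)
Lemma swap_assoc a b w : t w = 0 -> bf w a = 0 -> bf w b = 0 -> bf w (a ** b) = 0 ->
  b ** (a ** w) = (a ** b) ** w.
Proof.
move=> tw wa wb wab; have E1 := mul_anticomm (a ** w) b.
have E2 := altr_lin a b w.
have taw : t (a ** w) = 0 by rewrite trace_mul tw polarC wa mulr0 subr0.
have awb : bf (a ** w) b = 0.
  by rewrite polar_adjl !(na_mulE, polarE) wb wab mulr0 subr0.
move: E1 E2; rewrite tw taw awb (polarC b) wb !scale0r !subr0 add0r addr0 => <-.
by rewrite addrC => /addrI.
Qed.

Lemma associator_mul_perp a p w :
  t w = 0 -> bf w a = 0 -> bf w p = 0 -> bf w (p ** a) = 0 ->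
  associator a w (p ** w) = n w *: commutator p a.
Proof.
move=> tw wa wp wpa; have tpw : t (p ** w) = 0.
  by rewrite trace_mul tw polarC wp mulr0 subr0.
(* With a(pw) = (pa)w, this gives (aw)(pw) = n(w)(pa - t(p)a). The second identity gives w(pw) =
   n(w)(p - t(p)); the terms in t(p) cancel in the associator. *)
have E1 := altr_lin a w (p ** w).
rewrite (swap_assoc tw wp wa wpa) altr tw tpw polar_mul_selfr in E1.
have := altl_lin w p w; rewrite mul_self tw wp => E2.
apply: polar_inj => z; move/(congr1 (bf^~ z)): E1.
move/(congr1 (bf^~ z \o (na_mul B a))): E2.
rewrite /associator /commutator /= !(na_mulE, polarE) => E1 E2.
have {}E1 : bf (a ** (w ** (p ** w))) z = n w * bf (a ** p) z - n w * t p * bf a z.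
  by apply: (eq_of_sub E1); ring.
by rewrite E1; apply: (eq_of_sub E2); ring.
Qed.

Definition perp_quaternion h v w :=
  [/\ t w = 0, bf h w = 0, bf v w = 0 & bf (h ** v) w = 0].

Lemma perp_quaternion_lin h v a b w w' : perp_quaternion h v w ->
  perp_quaternion h v w' -> perp_quaternion h v (a *: w + b *: w').
Proof.
move=> [w1 w2 w3 w4] [w'1 w'2 w'3 w'4].
by split; rewrite ?(traceE, polarE) ?(w1, w2, w3, w4) ?(w'1, w'2, w'3, w'4); ring.
Qed.

Lemma perp_quaternion_mul1 h v w : perp_quaternion h v w -> perp_quaternion h v (h ** w).
Proof.
move=> [tw hw vw hvw]; split.
- by rewrite trace_mul tw hw; ring.
- by rewrite polar_mul_selfl tw mulr0.
- rewrite polarC polar_adjl !(na_mulE, polarE) polarC vw polarC hvw; ring.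
- by rewrite polar_mull vw mulr0.
Qed.

(** Multiplication by [v] has adjoint multiplication by its conjugate, which maps 1, h, v, hv back
    into their span; hence it preserves the orthogonal complement. *)
Lemma perp_quaternion_mul2 h v w : t v = 0 -> bf h v = 0 ->
  perp_quaternion h v w -> perp_quaternion h v (v ** w).
Proof.
move=> tv hv [tw hw vw hvw]; have vh : v ** h = t h *: v - h ** v.
  have := mul_anticomm h v; rewrite tv hv !scale0r subr0 addr0 => <-.
  by rewrite addrC addKr.
split.
- by rewrite trace_mul tw vw; ring.
- rewrite polarC polar_adjl !(na_mulE, polarE) vh !polarE tv.
  by rewrite (polarC w v) vw (polarC w (h ** v)) hvw; ring.
- by rewrite polar_mul_selfl tw mulr0.
- rewrite polarC polar_adjl !(na_mulE, polarE) mul_perp_swap // tv !polarE.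
  by rewrite (polarC w h) hw polar1r tw; ring.
Qed.

Lemma associator_quaternion h v w : t v = 0 -> bf h v = 0 -> perp_quaternion h v w ->
  associator h v (commutator h v ** w) = (disc h * n v) *: w.
Proof.
move=> tv hv pw; have vh : v ** h = t h *: v - h ** v.
  have := mul_anticomm h v; rewrite tv hv !scale0r subr0 addr0 => <-.
  by rewrite addrC addKr.
(* The product type packs two instances of [swap_assoc] into one rewrite rule. *)
have qE u : perp_quaternion h v u ->
    (v ** (h ** u) = (h ** v) ** u) * (h ** (v ** u) = (v ** h) ** u).
  case=> tu hu vu hvu; rewrite !swap_assoc ?vh ?polarE ?(polarC u) ?hu ?vu ?hvu //.
  by ring.
have pqw : perp_quaternion h v (commutator h v ** w).
  have -> : commutator h v ** w = 1 *: (v ** (h ** w)) + (-1) *: (h ** (v ** w)).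
    by rewrite !(qE w pw) /commutator !na_mulE scale1r scaleN1r.
  apply: perp_quaternion_lin.
    by apply: perp_quaternion_mul2 => //; apply: perp_quaternion_mul1.
  by apply: perp_quaternion_mul1; apply: perp_quaternion_mul2.
(* With q = [h, v], the associator becomes q(qw); q has trace 0 and norm - disc(h) n(v). *)
rewrite /associator (qE _ pqw) -na_mulNl -na_mulDl -/(commutator h v).
rewrite altl commutator_perp // normM norm_dbl trace_mul.
have -> : t (dbl h) * t v - bf (dbl h) v = 0 by rewrite !polarE polar1l tv hv; ring.
by rewrite scale0r add0r mulNr scaleNr opprK.
Qed.
End CompositionIdentities.

(** * Elements of trace zero *)

Section Span.
Variables (R : pzRingType) (M : lmodType R) (P : M -> Prop).

Lemma in_span_mem x : P x -> in_span P x.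
Proof.
by move=> Px; exists 1, (fun=> 1), (fun=> x); split=> //; rewrite big_ord1 scale1r.
Qed.
Lemma in_spanZ a x : in_span P x -> in_span P (a *: x).
Proof.
move=> [k [c [v [Pv ->]]]]; exists k, (fun j => a * c j), v; split=> //.
by rewrite scaler_sumr; apply: eq_bigr => j _; rewrite scalerA.
Qed.
Lemma in_spanD x y : in_span P x -> in_span P y -> in_span P (x + y).
Proof.
move=> [k [c [v [Pv ->]]]] [l [d [w [Pw ->]]]].
exists (k + l)%N, (fun j => match split j with inl p => c p | inr p => d p end),
  (fun j => match split j with inl p => v p | inr p => w p end).
split; first by move=> j; case: split.
rewrite big_split_ord; congr (_ + _); apply: eq_bigr => j _.
  by case: split_ordP => p /eqP; rewrite ?eq_lshift ?eq_lrshift // => /eqP ->.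
by case: split_ordP => p /eqP; rewrite ?eq_rshift ?eq_rlshift // => /eqP ->.
Qed.
End Span.

Section TraceZero.
Variables (R : comPzRingType) (B : naalg R) (n : B -> R).
Hypothesis octB : is_octonion n.

Local Notation "x ** y" := (na_mul B x y) (at level 40, left associativity).
Local Notation e1 := (na_one B).
Local Notation bf := (polar n).
Local Notation t := (trace n).
Local Notation disc h := (t h ^+ 2 - 4 * n h).
Local Notation dbl h := (2 *: h - t h *: e1).
Let pE := (polarDl octB, polarDr octB, polarZl octB, polarZr octB, polarNl octB, polarNr octB).
Let tE := (traceE octB).

Lemma commutator_trace0 x y : t (commutator x y) = 0.
Proof. by rewrite /commutator !tE trace_mulC // subrr. Qed.
Lemma associator_trace0 x y z : t (associator x y z) = 0.
Proof. by rewrite /associator !tE trace_mulA // subrr. Qed.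

Lemma in_span_trace0 (P : B -> Prop) x : (forall y, P y -> t y = 0) -> in_span P x -> t x = 0.
Proof.
move=> tP [k [c [v [Pv ->]]]]; rewrite /trace (lform_sum (polar_lin octB e1)) big1 // => j _.
by rewrite polarZr // -/(t _) tP // mulr0.
Qed.

Section AtMaximalIdeal.
Variable m : maximal_ideal R.

(** Stands in for halving [bf x x], so 2 may lie in [m]: the coordinates of [x] are values of
    [bf x], and expanding the norm along the dual basis leaves only terms in [m]. *)
Lemma maxid_norm x : (forall y, m (bf x y)) -> m (n x).
Proof.
move=> mx; have [_ [[Bproj _] _]] := octB.
have [k [b [s [slin sb]]]] := fg_projective_dual_basis Bproj.
rewrite (sb x); elim/big_rec: _ => [|j y _ my].
  by rewrite -(scale0r x) normZ // expr0n mul0r; apply: maxid0.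
have [z zP] := polar_surj octB (slin j).
have ms : m (s j x) by rewrite zP polarC.
rewrite normD normZ // polarZl // expr2 -mulrA.
by apply: maxidD; [apply: maxidD => //|]; apply: maxidMr.
Qed.

Lemma octonion_rank r a (x : 'I_r -> B) : (r < 8)%N -> ~ m a ->
  ~ (forall z, exists c : 'I_r -> R, forall y, m (bf (a *: z - \sum_j c j *: x j) y)).
Proof.
move=> r8 ma H; have [_ [Brank _]] := octB.
have [z zP] := rank_bound x Brank r8 ma; have [c cP] := H z.
have [f [flin]] := zP c; have [y ->] := polar_surj octB flin.
by rewrite polarC; apply.
Qed.
End AtMaximalIdeal.

(** The traces form an ideal; were it inside [m], [maxid_norm] would put [n e1 = 1] in [m]. *)
Lemma trace_surj : exists b, t b = 1.
Proof.
apply: (@ideal_local_global _ (fun r => exists b, t b = r)).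
  split; first by exists 0; rewrite /trace polar0r.
    by move=> _ _ [b <-] [c <-]; exists (b + c); rewrite tE.
  by move=> r _ [b <-]; exists (r *: b); rewrite tE.
move=> m; apply: contrapT => H.
apply: (@maxid_proper _ m); rewrite -(norm1 octB); apply: maxid_norm => y.
by apply: contrapT => my; apply: H; exists (t y); split; first by exists y.
Qed.

(** * Doubling elements with norm outside a maximal ideal *)

Section LocalChoices.
Variable m : maximal_ideal R.

Lemma exists_disc : exists h, ~ m (disc h).
Proof.
apply: contrapT => H; have mdisc h : m (disc h).
  by apply: contrapT => mh; apply: H; exists h.
have [m2|m2] := pselect (m 2).
  (* An element of trace 1 has discriminant 1 - 4 n(b), which is 1 modulo 2. *)
  have [b tb] := trace_surj; apply: (@maxid_proper _ m).
  rewrite (_ : 1 = disc b + (2 * n b) * 2); last by rewrite tb; ring.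
  by apply: maxidD => //; apply: maxidMl.
(* Otherwise polarizing [disc] shows that 2z - t(z) is orthogonal to everything modulo [m], so the
   unit would span [B] there. *)
apply: (@octonion_rank m 1 2 (fun=> e1) isT m2) => z; exists (fun=> t z) => y.
rewrite big_ord1 !pE polar1l.
apply: (@maxid_prime_mul _ m 2) m2.
rewrite (_ : 2 * _ = - (disc (z + y) - disc z - disc y)); last first.
  by rewrite !tE (normD n z y); ring.
by apply: maxidN; apply: maxidB => //; apply: maxidB.
Qed.

(* Cramer's rule for the Gram matrix of [e1, h], whose determinant is
   [- disc h]. *)
Definition proj_perp h z := disc h *: z + (2 * n h * t z - t h * bf h z) *: e1
  + (2 * bf h z - t h * t z) *: h.

Lemma trace_proj_perp h z : t (proj_perp h z) = 0.
Proof. by rewrite !tE; ring. Qed.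
Lemma polar_proj_perp h z : bf h (proj_perp h z) = 0.
Proof. by rewrite !pE polar1r // polar_diag //; ring. Qed.
Lemma proj_perp_trace0 h z : t z = 0 -> proj_perp h z = disc h *: z + bf h z *: dbl h.
Proof.
by move=> tz; apply: (polar_inj octB) => y; rewrite !pE tz polar1l; ring.
Qed.

Lemma exists_perp h : ~ m (disc h) -> exists v, [/\ t v = 0, bf h v = 0 & ~ m (n v)].
Proof.
move=> mh; apply: contrapT => H.
have mn v : t v = 0 -> bf h v = 0 -> m (n v).
  by move=> tv hv; apply: contrapT => mv; apply: H; exists v.
(* Norms in [m] on the complement put its polar form in [m]. As [proj_perp h z] is orthogonal to 1
   and h, pairing it with [y] differs only by the factor [disc h] from pairing it with
   [proj_perp h y]. *)
have mp z y : m (bf (proj_perp h z) y).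
  have tz := trace_proj_perp h z; have hz := polar_proj_perp h z.
  have ty := trace_proj_perp h y; have hy := polar_proj_perp h y.
  apply: (@maxid_prime_mul _ m (disc h)) mh.
  rewrite (_ : _ * bf _ y = bf (proj_perp h z) (proj_perp h y)).
    rewrite /polar; do !apply: maxidB; apply: mn => //.
      by rewrite (traceD octB) tz ty addr0.
    by rewrite (polarDr octB) hz hy addr0.
  rewrite [in X in _ = bf _ X]/proj_perp !(polarDr octB, polarZr octB) polar1r // tz.
  by rewrite (polarC n _ h) hz; ring.
apply: (@octonion_rank m 2 (disc h) (fun j => if j == 0 then e1 else h) isT mh) => z.
exists (fun j => if j == 0 then - (2 * n h * t z - t h * bf h z)
                 else - (2 * bf h z - t h * t z)) => y.
rewrite !big_ord_recl big_ord0 /= addr0 !scaleNr opprD !opprK addrA; exact: mp.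
Qed.

(* The same for [v, h v], which is orthogonal to [e1, h] and has Gram
   determinant [- disc h * n v ^ 2]; one factor [n v] is cancelled. *)
Definition proj_perp2 h v y := (disc h * n v) *: y
  + (2 * n h * bf v y - t h * bf (h ** v) y) *: v
  + (2 * bf (h ** v) y - t h * bf v y) *: (h ** v).

Lemma perp_quaternion_proj h v y : t v = 0 -> bf h v = 0 -> t y = 0 -> bf h y = 0 ->
  perp_quaternion n h v (proj_perp2 h v y).
Proof.
move=> tv hv ty hy; have [thv hhv] := perp_mull octB tv hv.
split; rewrite ?tE ?pE ?(polar_diag octB, normM octB, polar_mul_selfr octB);
  rewrite ?(polarC n (h ** v) v) ?(polar_mul_selfr octB) ?(tv, hv, ty, hy, thv, hhv); ring.
Qed.

Lemma exists_perp_quaternion h v : t v = 0 -> bf h v = 0 -> ~ m (disc h) -> ~ m (n v) ->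
  exists w, perp_quaternion n h v w /\ ~ m (n w).
Proof.
move=> tv hv mh mv; apply: contrapT => H.
have mn w : perp_quaternion n h v w -> m (n w).
  by move=> pw; apply: contrapT => mw; apply: H; exists w.
(* Projecting first off 1, h and then off v, hv multiplies [z] by [disc h * n v * disc h]; the list
   [c] below holds the negated corrections. *)
pose p z := proj_perp2 h v (proj_perp h z).
have pP z : perp_quaternion n h v (p z).
  apply: perp_quaternion_proj => //; first exact: trace_proj_perp.
  exact: polar_proj_perp.
have mp z y : m (bf (p z) y).
  apply: (@maxid_prime_mul _ m (disc h * n v * disc h)); last by do !apply: maxid_prime.
  rewrite (_ : _ * bf _ y = bf (p z) (p y)).
    rewrite /polar; do !apply: maxidB; apply: mn => //.
    by rewrite -(scale1r (p z)) -(scale1r (p y)); apply: perp_quaternion_lin.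
  have [tz hz vz hvz] := pP z.
  rewrite [in X in _ = bf _ X]/p /proj_perp2 /proj_perp !(polarDr octB, polarZr octB).
  by rewrite polar1r // tz !(polarC n (p z)) hz vz hvz; ring.
have ma : ~ m (disc h * n v * disc h) by do !apply: maxid_prime.
pose x (j : 'I_4) := nth 0 [:: e1; h; v; h ** v] j.
apply: (@octonion_rank m 4 (disc h * n v * disc h) x isT ma) => z.
pose c := [:: - (disc h * n v * (2 * n h * t z - t h * bf h z));
  - (disc h * n v * (2 * bf h z - t h * t z));
  - (2 * n h * bf v (proj_perp h z) - t h * bf (h ** v) (proj_perp h z));
  - (2 * bf (h ** v) (proj_perp h z) - t h * bf v (proj_perp h z))].
exists (fun j : 'I_4 => c`_j) => y.
suff -> : disc h * n v * disc h *: z - \sum_(j < 4) c`_j *: x j = p z by apply: mp.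
rewrite !big_ord_recl big_ord0 /= addr0; apply: (polar_inj octB) => u.
by rewrite /p {1}/proj_perp2 {1}/proj_perp !pE; ring.
Qed.
End LocalChoices.

Lemma trace0_comms x : t x = 0 -> comms x.
Proof.
pose J r := forall y, t y = 0 -> comms (r *: y).
suff J1 : J 1 by move=> /J1; rewrite scale1r.
apply: ideal_local_global => [|m].
  split=> [y ty|r s Jr Js y ty|r s Js y ty].
  - rewrite (_ : 0 *: y = 0 *: commutator y y); last by rewrite !scale0r.
    by apply: in_spanZ; apply: in_span_mem; exists y, y.
  - by rewrite scalerDl; apply: in_spanD; [apply: Jr|apply: Js].
  - by rewrite -scalerA; apply: in_spanZ; apply: Js.
have [h mh] := exists_disc m; have [v [tv hv mv]] := exists_perp mh.
exists (disc h * disc h * n v); split; last by do !apply: maxid_prime.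
move=> y ty; have tp := trace_proj_perp h y; have hp := polar_proj_perp h y.
(* [disc h *: y] is [proj_perp h y] minus a multiple of [dbl h]; each piece is, up to a scalar
   outside [m], a commutator. *)
have -> : (disc h * disc h * n v) *: y =
    n v *: commutator h (dbl h ** proj_perp h y) +
    (- (disc h * bf h y)) *: commutator v (h ** v).
  rewrite (commutator_dbl_mul octB tp hp) (commutator_perp_mul octB tv hv).
  rewrite proj_perp_trace0 //.
  by apply: (polar_inj octB) => u; rewrite !pE; ring.
apply: in_spanD; apply: in_spanZ; apply: in_span_mem.
  by exists h, (dbl h ** proj_perp h y).
by exists v, (h ** v).
Qed.

Lemma trace0_assocs x : t x = 0 -> assocs x.
Proof.
pose J r := forall y, t y = 0 -> assocs (r *: y).
suff J1 : J 1 by move=> /J1; rewrite scale1r.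
apply: ideal_local_global => [|m].
  split=> [y ty|r s Jr Js y ty|r s Js y ty].
  - rewrite (_ : 0 *: y = 0 *: associator y y y); last by rewrite !scale0r.
    by apply: in_spanZ; apply: in_span_mem; exists y, y, y.
  - by rewrite scalerDl; apply: in_spanD; [apply: Jr|apply: Js].
  - by rewrite -scalerA; apply: in_spanZ; apply: Js.
have [h mh] := exists_disc m; have [v [tv hv mv]] := exists_perp mh.
have [w [pw mw]] := exists_perp_quaternion tv hv mh mv.
exists (n w * disc h ^+ 3 * n v ^+ 2); split.
  2: by do !apply: maxid_prime => //; apply: maxid_expN.
move=> x' tx; have [tw hw vw hvw] := pw.
have [thv hhv] := perp_mull octB tv hv.
pose y := proj_perp h x'; pose z := proj_perp2 h v y.
have yE : y = _ := proj_perp_trace0 h tx.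
have ty : t y = 0 by apply: trace_proj_perp.
have hy : bf h y = 0 by apply: polar_proj_perp.
have pz : perp_quaternion n h v z by apply: perp_quaternion_proj.
(* With e = [dbl h], these are n(w) times ev, e(hv) and n(v)e. They remove the components that the
   two projections add to [x']. *)
pose X := associator v w (h ** w); pose Y := associator (h ** v) w (h ** w).
pose Z := associator (h ** v) w (v ** w).
have [wh wv whv] : [/\ bf w h = 0, bf w v = 0 & bf w (h ** v) = 0] by rewrite !(polarC n w).
have XE : X = n w *: commutator h v by apply: associator_mul_perp.
have YE : Y = n w *: commutator h (h ** v).
  by apply: associator_mul_perp => //; rewrite (altl octB) !pE whv wv; ring.
have ZE : Z = n w *: commutator v (h ** v).
  apply: associator_mul_perp => //.
  by rewrite (mul_perp_swap octB tv hv) !pE wh polar1r tw; ring.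
pose a := 2 * n h * bf v y - t h * bf (h ** v) y.
pose b := 2 * bf (h ** v) y - t h * bf v y.
(* Here z = disc(h) n(v) y + av + b hv. The coefficients of [X] and [Y] are those of - n(v) e(av + b
   hv) on v and hv; since e squares to disc(h), they cancel the terms in a and b. [Z] cancels the
   multiple of e in [y]. *)
have -> : (n w * disc h ^+ 3 * n v ^+ 2) *: x' =
    n w *: associator h v (commutator h v ** z)
    + (n v * (a * t h + 2 * b * n h)) *: X + (- (n v * (2 * a + b * t h))) *: Y
    + (- (disc h ^+ 2 * n v * bf h x')) *: Z.
  rewrite (associator_quaternion octB tv hv pz) XE YE ZE.
  rewrite (commutator_perp_mul octB tv hv) (commutator_perp octB tv hv).
  rewrite (commutator_perp octB thv hhv) !(na_mulE octB) (altl octB).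
  apply: (polar_inj octB) => u; rewrite /z /proj_perp2 -/a -/b yE !pE; ring.
do !apply: in_spanD; apply: in_spanZ; apply: in_span_mem.
- by exists h, v, (commutator h v ** z).
- by exists v, w, (h ** w).
- by exists (h ** v), w, (h ** w).
- by exists (h ** v), w, (v ** w).
Qed.
End TraceZero.

(** * Uniqueness of the trace *)

Section BaseChange.
Variables (R : comPzRingType) (S : comAlgType R) (M : lmodType R) (MS : lmodType S).
Variable i : M -> MS.
Hypothesis iB : is_base_change i.
Hypothesis Mproj : fg_projective M.

Lemma base_change_ind (P : MS -> Prop) : (forall x, P (i x)) ->
  (forall a u v, P u -> P v -> P (a *: u + v)) -> forall u, P u.
Proof.
move=> Pi PD u; have [k [b [h [_ hE]]]] := base_change_dual_basis iB Mproj.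
rewrite (hE u); elim/big_rec: _ => [|j v _ Pv]; last exact: PD.
by rewrite -(semilin0 (proj1 iB)).
Qed.

(** Replaces [polar_inj] over [S], where no norm is given: equations are tested by linear forms. *)
Lemma base_change_separated u v :
  (forall g : MS -> S, is_lform g -> g u = g v) -> u = v.
Proof.
move=> guv; have [k [b [h [hlin hE]]]] := base_change_dual_basis iB Mproj.
by rewrite (hE u) (hE v); apply: eq_bigr => j _; rewrite (guv _ (hlin j)).
Qed.

Lemma base_change_lform_eq (g g' : MS -> S) : is_lform g -> is_lform g' ->
  (forall x, g (i x) = g' (i x)) -> forall u, g u = g' u.
Proof.
move=> glin g'lin gg'; apply: base_change_ind => // a u v gu gv.
by rewrite glin g'lin gu gv.
Qed.

Lemma base_change_bilinear_eq (b b' : MS -> MS -> S) : is_bilinear b -> is_bilinear b' ->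
  (forall x y, b (i x) (i y) = b' (i x) (i y)) -> forall u v, b u v = b' u v.
Proof.
move=> [bl br] [b'l b'r] bb' u v.
apply: (base_change_lform_eq (bl v) (b'l v)) => x.
by apply: (base_change_lform_eq (br _) (b'r _)).
Qed.
End BaseChange.

(** The constant term stays existential, so the notion needs no norm and transports along
    isomorphisms. *)
Definition quadratic_trace (S : pzRingType) (A : naalg S) (T : A -> S) : Prop :=
  [/\ is_lform T, T (na_one A) = 2 &
      forall z, exists c, na_mul A z z = T z *: z + c *: na_one A].

Lemma quadratic_trace_iso (S : pzRingType) (A C : naalg S) (f : A -> C) (T : C -> S) :
  is_alg_iso f -> quadratic_trace T -> quadratic_trace (T \o f).
Proof.
move=> [flin [/bij_inj finj [f1 fM]]] [Tlin T1 Tquad]; split=> [a u v||z] /=.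
- by rewrite flin Tlin.
- by rewrite f1.
have [c E] := Tquad (f z); exists c; apply: finj.
by rewrite fM E (linD flin) !(linZ flin) f1.
Qed.

Section TraceBaseChange.
Variables (R : comPzRingType) (B : naalg R) (n : B -> R).
Hypothesis octB : is_octonion n.
Variables (S : comAlgType R) (BS : naalg S) (i : B -> BS).
Hypothesis iB : is_alg_base_change i.

Local Notation bf := (polar n).
Local Notation t := (trace n).

Let Bproj : fg_projective B. Proof. by case: octB => [_ [[]]]. Qed.
Let iBC : is_base_change i. Proof. by case: iB => _ []. Qed.
Let ilin : is_semilin i. Proof. by case: iBC. Qed.
Let i1 : i (na_one B) = na_one BS. Proof. by case: iB => _ [_ []]. Qed.
Let iM x y : i (na_mul B x y) = na_mul BS (i x) (i y).
Proof. by case: iB => _ [_ [_]]. Qed.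
Let mulSl z : is_lin (fun u => na_mul BS u z). Proof. by case: iB => [[[]]]. Qed.
Let mulSr z : is_lin (na_mul BS z). Proof. by case: iB => [[[]]]. Qed.

Lemma base_change_quadratic_trace (T : BS -> S) : is_lform T ->
  (forall x, T (i x) = (t x)%:A) -> quadratic_trace T.
Proof.
move=> Tlin Ti; split=> //.
  by rewrite -i1 Ti trace1 // scaler_nat.
(* The quadratic equation is not additive in z, so extending it from the image of [i] requires its
   polarization, extended in each variable. *)
have lin_mix (u v : BS) : exists c,
    na_mul BS u v + na_mul BS v u = T u *: v + T v *: u + c *: na_one BS.
  move: u; apply: (base_change_ind iBC Bproj) => [x|a u u' [c E] [c' E']].
    move: v; apply: (base_change_ind iBC Bproj) => [y|a v v' [c E] [c' E']].
      exists (- bf x y)%:A; rewrite -!iM -(semilinD ilin) (mul_anticomm octB).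
      by rewrite !(semilinD ilin) -scaleNr !(semilinZ ilin) i1 !Ti.
    exists (a * c + c'); apply: (base_change_separated iBC Bproj) => g glin.
    move/(congr1 g): E; move/(congr1 g): E'.
    rewrite (mulSl (i x)) (mulSr (i x)) Tlin.
    rewrite !(lformD glin, lformZ glin) => E' E.
    apply: (eq_of_sub (f_equal2 (fun p q => a * p + q) E E')); ring.
  exists (a * c + c'); apply: (base_change_separated iBC Bproj) => g glin.
  move/(congr1 g): E; move/(congr1 g): E'.
  rewrite (mulSl v) (mulSr v) Tlin.
  rewrite !(lformD glin, lformZ glin) => E' E.
  apply: (eq_of_sub (f_equal2 (fun p q => a * p + q) E E')); ring.
apply: (base_change_ind iBC Bproj) => [x|a u v [c E] [c' E']].
  exists (- n x)%:A; rewrite -iM (mul_self octB) -scaleNr (semilinD ilin).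
  by rewrite !(semilinZ ilin) i1 Ti.
have [d E''] := lin_mix u v; exists (a ^+ 2 * c + a * d + c').
apply: (base_change_separated iBC Bproj) => g glin.
move/(congr1 g): E; move/(congr1 g): E'; move/(congr1 g): E''.
rewrite (mulSl _) !(mulSr _) Tlin !(lformD glin, lformZ glin) => E'' E' E.
apply: (eq_of_sub (f_equal2 +%R (f_equal2 (fun p q => a ^+ 2 * p + a * q) E E'') E')).
ring.
Qed.

(** The difference f of the two traces is linear, vanishes at the unit, and f(x) i(x) is always a
    multiple of the unit. A trace 1 element [b] splits [B] as the unit line plus the kernel of
    [bf b], and f is shown to vanish on that kernel. *)
Lemma quadratic_trace_unique (T : BS -> S) : quadratic_trace T ->
  forall x, T (i x) = (t x)%:A.
Proof.
move=> [Tlin T1 Tquad] x; apply/eqP; rewrite -subr_eq0; apply/eqP; move: x.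
pose f x := T (i x) - (t x)%:A; rewrite -/(forall x, f x = 0).
have fD x y : f (x + y) = f x + f y.
  by rewrite /f (semilinD ilin) (lformD Tlin) traceD // scalerDl opprD addrACA.
have fZ r x : f (r *: x) = r *: f x.
  by rewrite /f (semilinZ ilin) (lformZ Tlin) traceZ // mulr_algl scalerBr scalerA.
have f1 : f (na_one B) = 0 by rewrite /f i1 T1 trace1 // scaler_nat subrr.
have fquad x : exists c, f x *: i x = c *: na_one BS.
  have [c E] := Tquad (i x); exists (- ((n x)%:A + c)).
  apply: (base_change_separated iBC Bproj) => g glin; move/(congr1 g): E.
  rewrite -iM (mul_self octB) -scaleNr (semilinD ilin) !(semilinZ ilin) i1.
  rewrite /f !(lformD glin, lformZ glin) scaleNr => E; apply: (eq_of_sub (esym E)); ring.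
have [b tb] := trace_surj octB.
have l1 : bf b (na_one B) = 1 by rewrite polar1r.
have [L [Llin Li]] := base_change_form iBC (polar_lin octB b).
(* [L] reads off the multiple of the unit and vanishes at [i w]. *)
have fker w : bf b w = 0 -> f w *: i w = 0.
  move=> bw; have [c E] := fquad w; rewrite E.
  move/(congr1 L): E; rewrite !(lformZ Llin) Li bw -i1 Li l1 scale0r scale1r mulr0 mulr1.
  by move=> <-; rewrite scale0r.
have fpol w y : bf b w = 0 -> bf y w *: f w = 0.
  move=> /fker E; have [g [glin gi]] := base_change_form iBC (polar_lin octB y).
  by move/(congr1 g): E; rewrite (lformZ glin) gi (lform0 glin) mulr_algr.
have fker0 z : bf b z = 0 -> f z = 0.
  move=> bz; pose J r := r *: f z = 0.
  suff : J 1 by rewrite /J scale1r.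
  apply: ideal_local_global => [|m].
    split; rewrite /J; first by rewrite scale0r.
      by move=> r s Jr Js; rewrite scalerDl Jr Js addr0.
    by move=> r s Js; rewrite -scalerA Js scaler0.
  (* If no such pair existed, the unit would span [B] modulo [m]. *)
  have [w [y [bw my]]] : exists w y, bf b w = 0 /\ ~ m (bf y w).
    apply: contrapT => H.
    apply: (@octonion_rank _ _ _ octB m 1 1 (fun=> na_one B) isT (maxid_proper (m:=m))) => w.
    exists (fun=> bf b w) => y; rewrite big_ord1 scale1r polarC.
    apply: contrapT => my; apply: H; exists (w - bf b w *: na_one B), y; split=> //.
    by rewrite polarDr // polarNr // polarZr // l1 mulr1 subrr.
  exists (bf y w * bf y w); split; last exact: maxid_prime.
  (* Polarization leaves bf(y,w) f(z) + bf(y,z) f(w) = 0; one more factor bf(y,w) kills the second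
     term. *)
  have := fpol (w + z) y; rewrite !(polarDr octB) bw bz addr0 => /(_ erefl).
  rewrite fD scalerDr !(scalerDl _ (bf y w) (bf y z)) fpol // (fpol z) // addr0 add0r.
  move=> /(congr1 (GRing.scale (bf y w))).
  rewrite scaler0 scalerDr !scalerA [bf y w * bf y z]mulrC -(scalerA _ _ (f w)).
  by rewrite fpol // scaler0 add0r.
move=> x; rewrite -[x](subrK (bf b x *: na_one B)) fD fZ f1 scaler0 addr0.
by apply: fker0; rewrite polarDr // polarNr // polarZr // l1 mulr1 subrr.
Qed.
End TraceBaseChange.

(** * The quadratic equation and trace form of the Zorn algebra *)

Section ZornTrace.
Variable S : comPzRingType.
Implicit Types z w : 'rV[S]_8.

Lemma dot3E (u v : 'rV[S]_3) : dot3 u v = u 0 (inord 0) * v 0 (inord 0)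
  + u 0 (inord 1) * v 0 (inord 1) + u 0 (inord 2) * v 0 (inord 2).
Proof.
rewrite /dot3 !big_ord_recr big_ord0 /= add0r.
by congr (_ * _ + _ * _ + _ * _); congr (_ _ _); apply: val_inj; rewrite /= inordK.
Qed.

Lemma zUE z k : (k < 3)%N -> zU z 0 (inord k) = z 0 (inord (2 + k)).
Proof. by move=> k3; rewrite mxE inordK. Qed.
Lemma zXE z k : (k < 3)%N -> zX z 0 (inord k) = z 0 (inord (5 + k)).
Proof. by move=> k3; rewrite mxE inordK. Qed.

Lemma row8P z w : (forall k, (k < 8)%N -> z 0 (inord k) = w 0 (inord k)) -> z = w.
Proof. by move=> zw; apply/rowP => j; rewrite -[j]inord_val; apply: zw. Qed.

Lemma zmkE (a1 a2 : S) u x k : (k < 8)%N -> zmk a1 a2 u x 0 (inord k) =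
  if k == 0%N then a1 else if k == 1%N then a2
  else if (k < 5)%N then u 0 (inord (k - 2)) else x 0 (inord (k - 5)).
Proof. by move=> k8; rewrite mxE inordK. Qed.

Let lin_coord (a c : S) z w j : (a *: z - c *: w) 0 j = a * z 0 j - c * w 0 j.
Proof. by rewrite !mxE. Qed.

Lemma zor_trace_lin : is_lform (@zor_trace S).
Proof. by move=> r z w; rewrite /zor_trace /zA1 /zA2 !mxE; ring. Qed.

Lemma zor_trace_one : zor_trace (zone S) = 2.
Proof. by rewrite /zor_trace /zA1 /zA2 !mxE !inordK. Qed.

Lemma zmul_self z : zmul z z = zor_trace z *: z - zor_norm z *: zone S.
Proof.
apply: row8P => -[|[|[|[|[|[|[|[|k]]]]]]]] // _.
all: rewrite lin_coord /zmul /zone !zmkE //= ?mxE ?inordK //=.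
all: rewrite /zor_trace /zor_norm ?dot3E ?zUE ?zXE // /zA1 /zA2.
all: ring.
Qed.

Lemma zor_quadratic_trace : quadratic_trace (@zor_trace S : Zor S -> S).
Proof.
split; [exact: zor_trace_lin|exact: zor_trace_one|].
by move=> z; exists (- zor_norm z); rewrite scaleNr; apply: zmul_self.
Qed.

Lemma tau_zorE z w : tau_zor z w = zA1 z * zA1 w - dot3 (zU z) (zX w)
  + (- dot3 (zX z) (zU w) + zA2 z * zA2 w).
Proof. by rewrite /tau_zor /zor_trace [zA1 (zmul _ _)]zmkE // [zA2 (zmul _ _)]zmkE. Qed.

Lemma tau_zor_bilinear : is_bilinear (@tau_zor S).
Proof.
split=> z r u v; rewrite !tau_zorE !dot3E !zUE ?zXE // /zA1 /zA2 !mxE; ring.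
Qed.
End ZornTrace.

(** * Centrality, the trace form and the IBF-principle *)

Theorem theorem6p13 (R : comPzRingType) (B : naalg R) (n : B -> R) :
  is_octonion n ->
  (* (a) *)
  (central B /\
   (forall x : B, in_sum (@assocs R B) (@comms R B) x <-> assocs x) /\
   (forall x : B, assocs x <-> comms x)) /\
  (* (b) *)
  (is_bilinear (tau n) /\ invariant_form (tau n) /\ nonsingular (tau n) /\
   aut_invariant (tau n) /\ is_descended_tau (tau n)) /\
  (* (c) *)
  IBF_principle (tau n).
Proof.
move=> octB.
have assocsE (x : B) : @assocs R B x <-> trace n x = 0.
  split=> [|tx]; last exact: (trace0_assocs octB).
  by apply: (in_span_trace0 octB) => _ [a [b [c ->]]]; apply: associator_trace0.
have commsE (x : B) : @comms R B x <-> trace n x = 0.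
  split=> [|tx]; last exact: (trace0_comms octB).
  by apply: (in_span_trace0 octB) => _ [a [b ->]]; apply: commutator_trace0.
have [b tb] := trace_surj octB.
have tau_bil : is_bilinear (tau n).
  split=> z r x y; rewrite /tau (na_mulDl octB, na_mulDr octB);
    by rewrite (na_mulZl octB, na_mulZr octB) (traceD octB) (traceZ octB).
have factor_trace (N : lmodType R) (f : B -> N) : is_lin f ->
    (forall x y, f (na_mul B x y) = f (na_mul B y x)) ->
    forall x, f x = trace n x *: f b.
  (* [x - trace n x *: b] has trace 0, so it is a combination of commutators, all killed by [f]. *)
  move=> flin fC x; apply/eqP; rewrite -subr_eq0 -(linZ flin) -(linB flin); apply/eqP.
  have /commsE [k [c [v [vP ->]]]] : trace n (x - trace n x *: b) = 0.
    by rewrite !(traceE octB) tb; ring.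
  rewrite (lin_sum flin) big1 // => j _; have [y [z ->]] := vP j.
  by rewrite (linZ flin) (linB flin) fC subrr scaler0.
split; [split; [split|split]|split; [split=> //; split; [|split; [|split]]|]].
- exact: octonion_faithful octB.
- move=> f [flin fM]; pose c := f (na_one B).
  have fl x : f x = na_mul B c x by rewrite -(fM _ x).1 (na_mul1l octB).
  have fr x : f x = na_mul B x c by rewrite -(fM x _).2 (na_mul1r octB).
  (* [f] is both left and right multiplication by [c], so its trace vanishes on commutators and is a
     multiple of the trace. *)
  have tcC x y : trace n (f (na_mul B x y)) = trace n (f (na_mul B y x)).
    by rewrite (fM x y).1 (fM y x).2 (trace_mulC octB).
  have tflin : is_lin (trace n \o f : B -> R^o).
    by move=> r x y; rewrite /= flin (traceD octB) (traceZ octB).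
  have tfE x : trace n (na_mul B c x) = trace n x * trace n (f b).
    by rewrite -fl; apply: factor_trace tflin tcC x.
  exists (trace n c - trace n (f b)) => x; rewrite fl.
  have {1}-> : c = (trace n c - trace n (f b)) *: na_one B.
    (* Since t(cy) = t(c) t(y) - bf(c,y), the form [bf c] is a multiple of the trace, so [c] is that
       multiple of the unit. *)
    apply: (polar_inj octB) => y.
    have := tfE y; rewrite (trace_mul octB) => E.
    by rewrite polarZl // polar1l; apply: (eq_of_sub (esym E)); ring.
  by rewrite (na_mulZl octB) (na_mul1l octB).
- move=> x; split=> [[y [z [/assocsE ty [/commsE tz ->]]]]|xA].
    by apply/assocsE; rewrite (traceD octB) ty tz addr0.
  exists x, 0; split=> //; split; last by rewrite addr0.
  by apply/commsE; rewrite /trace polar0r.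
- by move=> x; rewrite assocsE commsE.
- move=> x y z; rewrite /tau (trace_mulA octB); split=> //.
  by rewrite (trace_mulC octB) (trace_mulA octB).
- split=> [x x' xx'|f flin].
    (* [tau] is the polar form with its first argument conjugated; equality of traces then undoes
       the conjugation. *)
    have E : trace n x *: na_one B - x = trace n x' *: na_one B - x'.
      by apply: (polar_inj octB) => y; rewrite -!(trace_mul_conjl octB); apply: xx'.
    have tE : trace n x = trace n x'.
      by have := xx' (na_one B); rewrite /tau !(na_mul1r octB).
    by move: E; rewrite tE => /addrI /oppr_inj.
  have [x xP] := polar_surj octB flin.
  exists (trace n x *: na_one B - x) => y; rewrite xP /tau (trace_mul_conjl octB).
  congr (polar n _ y); rewrite !(traceE octB).
  by apply: (polar_inj octB) => z; rewrite !(polarE octB); ring.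
- move=> S BS i betaS iB [[betal betar] betai] phi phi_iso.
  have iBC : is_base_change i by case: iB => _ [].
  have [mulSl mulSr] : is_bilin_map (na_mul BS) by case: iB => [[]].
  have Bproj : fg_projective B by case: octB => [_ [[]]].
  (* [T] extends the trace to [BS] and determines [betaS]; its pullback by [phi] is again a
     quadratic trace, hence equals [T]. *)
  pose T u := betaS u (na_one BS).
  have Tlin : is_lform T by apply: betal.
  have Ti x : T (i x) = (trace n x)%:A.
    by rewrite /T; case: iB => _ [_ [<- _]]; rewrite betai /tau (na_mul1r octB).
  have betaE : forall u v, betaS u v = T (na_mul BS u v).
    apply: (base_change_bilinear_eq iBC Bproj) => //.
      by split=> z r u v; rewrite (mulSl, mulSr) Tlin.
    by move=> x y; case: (iB) => _ [_ [_ <-]]; rewrite betai Ti.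
  have Tphi : quadratic_trace (T \o phi).
    by apply: quadratic_trace_iso => //; apply: (base_change_quadratic_trace octB iB).
  have TphiE : forall u, (T \o phi) u = T u.
    apply: (base_change_lform_eq iBC Bproj) => //; first by case: Tphi.
    by move=> x; rewrite (quadratic_trace_unique octB iB Tphi) Ti.
  by case: phi_iso => _ [_ [_ phiM]] u v; rewrite !betaE -phiM; apply: TphiE.
- move=> S BS i theta _ iB theta_iso; split.
    have [thlin _] := theta_iso; have [zl zr] := tau_zor_bilinear S.
    by split=> z r u v; rewrite thlin (zl, zr).
  have Tth := quadratic_trace_iso theta_iso (zor_quadratic_trace S).
  move=> x y; rewrite /tau -(quadratic_trace_unique octB iB Tth) /=.
  case: (iB) => _ [_ [_ ->]]; by case: theta_iso => _ [_ [_ ->]].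
- move=> Q pi [[pil pir] [piM piU]] g glin gpi.
  (* The relations give pi(x,y) = pi(xy,1) and pi(xy,1) = pi(yx,1), so [factor_trace] applies to the
     map sending u to pi(u,1). *)
  have piE x y : pi x y = tau n x y *: pi b (na_one B).
    have pi1 u v : pi (na_mul B u v) (na_one B) = pi u v.
      by rewrite (piM u v _).1 (na_mul1r octB).
    rewrite -pi1; apply: (factor_trace _ (fun u => pi u (na_one B))) => // u v.
    by rewrite (piM u v _).2 (na_mul1l octB) pi1.
  exists (fun r => r *: pi b (na_one B)) => [q|r]; last first.
    by rewrite (lformZ glin) gpi /tau (na_mul1r octB) tb mulr1.
  (* Universality of [pi] against itself: [g] followed by scaling [pi b (na_one B)] agrees with the
     identity on all values of [pi]. *)
  have [_ unq] := piU Q pi (conj pil pir) piM.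
  apply: (unq (fun q => g q *: pi b (na_one B)) id) => // [r u v|x y].
    by rewrite glin scalerDl scalerA.
  by rewrite gpi -piE.
Qed.
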